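(* Let $n\ge 2$ be an integer and consider the piecewise smooth system $$\begin{pmatrix}\dot x\\ \dot y\end{pmatrix}=\begin{cases}\begin{pmatrix}xy+\varepsilon f^+(x,y)\\ \frac32y^2-2x^2+2x+\varepsilon g^+(x,y)\end{pmatrix}, & y>0,\\[3mm] \begin{pmatrix}xy+\varepsilon f^-(x,y)\\ \frac32y^2-2x^2+2x+\varepsilon g^-(x,y)\end{pmatrix}, & y<0,\end{cases}$$ where $0<|\varepsilon|\ll 1$ and $f^\pm(x,y)=\sum_{i+j=0}^n a^\pm_{i,j}x^iy^j$, $g^\pm(x,y)=\sum_{i+j=0}^n b^\pm_{i,j}x^iy^j$ ($i,j\ge 0$) are real polynomials of degree at most $n$. Suppose that $a^+_{i,j}=a^-_{i,j}$ and $b^+_{i,j}=b^-_{i,j}$ for all $i,j$. Consider the limit cycles of this system bifurcating from the period annulus $\{\Gamma_h : h\in(-1,0)\}$ of the unperturbed system ($\varepsilon=0$). Then, counting multiplicity: (i) if $n=2,3$, the number of limit cycles bifurcating from the period annulus is not more than $4$; (ii) if $n\ge 4$, the number of limit cycles bifurcating from the period annulus is not more than $3n-8$.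
   Context: The unperturbed system $\dot x=xy,\ \dot y=\frac32y^2-2x^2+2x$ has the first integral $H(x,y)=x^{-3}\big(\frac12y^2-2x^2+x\big)$ with integrating factor $x^{-4}$. It has a center at $(1,0)$, corresponding to $H=-1$. For $h\in(-1,0)$ let $\Gamma_h$ be the closed orbit around $(1,0)$ contained in $\{H=h\}\cap\{x>0\}$; these ovals form the period annulus. Let $\Gamma_h^+=\Gamma_h\cap\{y>0\}$ and $\Gamma_h^-=\Gamma_h\cap\{y<0\}$, oriented by the unperturbed flow (so $\Gamma_h^+$ goes from left to right and $\Gamma_h^-$ from right to left). The first order Melnikov function is $$M(h)=\int_{\Gamma_h^+}x^{-4}\big[g^+dx-f^+dy\big]+\int_{\Gamma_h^-}x^{-4}\big[g^-dx-f^-dy\big],\quad h\in(-1,0).$$ ''The number of limit cycles bifurcating from the period annulus (counting multiplicity)'' is understood at first order in $\varepsilon$, i.e. as the number controlled by $M$: the number of isolated zeros of $M$ in $(-1,0)$, counted with multiplicity. *)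

(* Defs.v *)
From Stdlib Require Import Reals Lra Lia List.
From Coquelicot Require Import Coquelicot.
Open Scope R_scope.

(* sum over all i, j >= 0 with i + j <= n; sum_f_R0 has an inclusive bound. *)
Definition poly2 (n : nat) (a : nat -> nat -> R) (x y : R) : R :=
  sum_f_R0 (fun i => sum_f_R0 (fun j => a i j * x ^ i * y ^ j) (n - i)) n.

Definition H (x y : R) : R := / x ^ 3 * (y ^ 2 / 2 - 2 * x ^ 2 + x).

Definition X0 (x y : R) : R := x * y.
Definition Y0 (x y : R) : R := 3 / 2 * y ^ 2 - 2 * x ^ 2 + 2 * x.

(* t |-> (x t, y t) runs once, in time T, through a closed orbit of the
   unperturbed system in {H = h}, x > 0.  The condition [first_return] makes T
   the minimal period and excludes the equilibrium (1,0); since (1,0) is the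
   only equilibrium with x > 0, every such orbit surrounds it.  For -1 < h < 0
   such orbits exist: x = (1 - s cos u) / (-h) and
   y = sqrt (2 (1 - s cos u)) (s / (-h)) sin u with s = sqrt (1 + h), where
   u = u(t) solves u' = x sqrt (2 (1 - s cos u)). *)
Record closed_orbit (h : R) (x y : R -> R) (T : R) : Prop := {
  period_pos : 0 < T;
  flow_x : forall t, is_derive x t (X0 (x t) (y t));
  flow_y : forall t, is_derive y t (Y0 (x t) (y t));
  x_pos : forall t, 0 < x t;
  on_level : forall t, H (x t) (y t) = h;
  periodic : forall t, x (t + T) = x t /\ y (t + T) = y t;
  first_return : forall t, 0 < t < T -> (x t, y t) <> (x 0, y 0)
}.

(* Integral of P dx + Q dy along t |-> (x t, y t), a <= t <= b. *)
Definition line_integral (P Q : R -> R -> R) (x y : R -> R) (a b : R) : R :=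
  RInt (fun t => P (x t) (y t) * Derive x t + Q (x t) (y t) * Derive y t) a b.

Definition melnikov_arc (f g : R -> R -> R) (x y : R -> R) (a b : R) : R :=
  line_integral (fun u v => / u ^ 4 * g u v) (fun u v => - (/ u ^ 4 * f u v))
    x y a b.

(* m = M(h): the closed orbit is run through along the flow, starting on the
   x-axis; the time interval (0,tau) covers its part in y > 0 and (tau,T) its
   part in y < 0.  The value does not depend on the solution chosen, which is
   unique up to shifting the time by multiples of T. *)
Definition is_melnikov (fp gp fm gm : R -> R -> R) (h m : R) : Prop :=
  exists (x y : R -> R) (tau T : R),
    closed_orbit h x y T /\
    0 < tau < T /\
    (forall t, 0 < t < tau -> 0 < y t) /\
    (forall t, tau < t < T -> y t < 0) /\
    m = melnikov_arc fp gp x y 0 tau + melnikov_arc fm gm x y tau T.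

Definition isolated_zero (M : R -> R) (h : R) : Prop :=
  M h = 0 /\ locally' h (fun u => M u <> 0).

(* Derive_n is total; the Melnikov function is analytic on (-1,0), so there it
   is the genuine derivative. *)
Definition multiplicity_ge (M : R -> R) (h : R) (k : nat) : Prop :=
  forall j, (j < k)%nat -> Derive_n M j h = 0.

(* At most N isolated zeros in (a,b), counted with multiplicity: no finite
   family of distinct isolated zeros h, each of multiplicity at least k_h, has
   total sum of the k_h above N.  In particular there are finitely many of
   them and each has finite multiplicity. *)
Definition isolated_zeros_at_most (M : R -> R) (a b : R) (N : nat) : Prop :=
  forall l : list (R * nat),
    NoDup (map fst l) ->
    (forall h k, In (h, k) l ->
       a < h < b /\ isolated_zero M h /\ multiplicity_ge M h k) ->
    (list_sum (map snd l) <= N)%nat.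

(* Main.v *)
Require Import Defs.
From Stdlib Require Import Reals Lra Lia List FinFun.
From Coquelicot Require Import Coquelicot.
Open Scope R_scope.

(* The proof gives the bound n, which is at most 4 for n = 2, 3 and at most
   3n - 8 for n >= 4.  Let z = 1 + h and s = sqrt z.  On the orbit of level h
   there is an angle v, growing from 0 to 2 pi in one period, with
   1/x = 1 + s cos v, y = s x sqrt(2x) sin v and dv/dt = sqrt(2x).
   Integrating exact forms reduces M to a combination, with constant
   coefficients, of the integrals of x^(i-5) y dx, 0 <= i <= n.  In the angle v
   these are sqrt 2 z times the integral of (1 + s cos v)^(3/2-i) sin^2 v, and
   the binomial series turns them into power series in z whose coefficients are
   weights independent of i, all nonnegative, times polynomials of degree i in
   the index.  So M(h) = sum_k w_k S(k) z^k with w_k >= 0 and S a polynomial of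
   degree at most n, and Descartes' rule of signs for power series leaves at
   most n zeros in 0 < z < 1. *)

(** * Polynomial functions and Descartes' rule for power series *)

(** The level set [H = h] is a circle in disguise: it reads (1/x - 1)^2 + y^2/(2x^3) = 1 + h, and in
    the coordinates 1/x - 1 and y/(x sqrt(2x)) the flow is a rotation with speed sqrt(2x). This is
    the origin of the angle and of the variable z = 1 + h. Since the two perturbations agree, the
    arcs glue to one closed integral, so exact forms drop out. The forms x^(i-5) y^j dx with j even
    integrate to zero, because y^2 is a function of x on the orbit and x returns to its starting
    value. For j odd, exact forms trade y^2 for x^2 and x, which never raises the total degree;
    hence only i <= n remains. The polynomials in the index come from binom(b-1,k) = binom(b,k)
    (b-k)/b: lowering the exponent by one costs one linear factor, so every exponent 3/2 - i shares
    the weights of the exponent 3/2, whose even coefficients are nonnegative. The coefficients w_k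
    S(k) change sign only where S does. A real root c of S can be removed with z d/dz - c, which up
    to a positive factor is the derivative of z^(-c) times the series; Rolle's theorem then handles
    multiple zeros together with simple ones. *)

(* Polynomial functions of degree at most n, through divided differences; this
   form gives the factor theorem for free. *)
Fixpoint degree_le (n : nat) (S : R -> R) : Prop :=
  match n with
  | O => forall t u, S t = S u
  | Datatypes.S m => forall a, exists S1, degree_le m S1 /\
      forall t, S t = S a + (t - a) * S1 t
  end.

Lemma degree_le_ext (n : nat) (P Q : R -> R) :
  (forall t, P t = Q t) -> degree_le n P -> degree_le n Q.
Proof.
  destruct n as [|n]; simpl; intros E HP.
  - intros t u. rewrite <- !E. apply HP.
  - intros a. destruct (HP a) as [S1 [D1 E1]]. exists S1. split; [exact D1|].
    intros t. rewrite <- !E. apply E1.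
Qed.

Lemma degree_le_const (n : nat) (c : R) : degree_le n (fun _ => c).
Proof.
  revert c. induction n as [|n IH]; simpl; intros c; [reflexivity|].
  intros a. exists (fun _ => 0). split; [apply IH | intros; ring].
Qed.

Lemma degree_le_plus (n : nat) (P Q : R -> R) :
  degree_le n P -> degree_le n Q -> degree_le n (fun t => P t + Q t).
Proof.
  revert P Q. induction n as [|n IH]; simpl; intros P Q HP HQ.
  - intros t u. rewrite (HP t u), (HQ t u). reflexivity.
  - intros a. destruct (HP a) as [P1 [DP EP]]. destruct (HQ a) as [Q1 [DQ EQ]].
    exists (fun t => P1 t + Q1 t). split; [now apply IH|].
    intros t. rewrite (EP t), (EQ t). ring.
Qed.

Lemma degree_le_scal (n : nat) (c : R) (P : R -> R) :
  degree_le n P -> degree_le n (fun t => c * P t).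
Proof.
  revert P. induction n as [|n IH]; simpl; intros P HP.
  - intros t u. rewrite (HP t u). reflexivity.
  - intros a. destruct (HP a) as [P1 [DP EP]].
    exists (fun t => c * P1 t). split; [now apply IH|].
    intros t. rewrite (EP t). ring.
Qed.

Lemma degree_le_weaken (m n : nat) (P : R -> R) :
  (m <= n)%nat -> degree_le m P -> degree_le n P.
Proof.
  revert m P. induction n as [|n IH]; intros m P L HP.
  - replace 0%nat with m by lia. exact HP.
  - destruct m as [|m].
    + apply degree_le_ext with (fun _ => P 0); [intros t; apply HP|].
      apply degree_le_const.
    + intros a. destruct (HP a) as [P1 [DP EP]]. exists P1. split; [|exact EP].
      apply IH with m; [lia | exact DP].
Qed.

Lemma degree_le_mul_linear (n : nat) (c d : R) (P : R -> R) :
  degree_le n P -> degree_le (Datatypes.S n) (fun t => (c * t + d) * P t).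
Proof.
  revert P. induction n as [|n IH]; intros P HP a.
  - exists (fun _ => c * P a). split; [apply degree_le_const|].
    intros t. rewrite (HP t a). ring.
  - destruct (HP a) as [P1 [DP EP]].
    exists (fun t => c * P a + (c * t + d) * P1 t). split.
    + apply degree_le_plus; [apply degree_le_const | now apply IH].
    + intros t. rewrite (EP t). ring.
Qed.

Lemma degree_le_derivable (n : nat) (P : R -> R) :
  degree_le n P -> forall a, ex_derive P a.
Proof.
  revert P. induction n as [|n IH]; intros P HP a.
  - apply ex_derive_ext with (fun _ => P 0); [intros t; apply HP|].
    apply ex_derive_const.
  - destruct (HP a) as [P1 [DP EP]].
    apply ex_derive_ext with (fun t => P a + (t - a) * P1 t); [now intros t|].
    pose proof (IH P1 DP a). auto_derive. auto.
Qed.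

Lemma degree_le_root (n : nat) (P : R -> R) (u v : R) :
  degree_le n P -> P u < 0 -> 0 < P v -> exists c, P c = 0.
Proof.
  intros HP Hu Hv.
  assert (C : forall Q, degree_le n Q -> continuity Q).
  { intros Q HQ t. apply continuity_pt_filterlim.
    now apply (ex_derive_continuous Q), degree_le_derivable with n. }
  destruct (Rlt_le_dec u v) as [L|L].
  - destruct (IVT P u v (C P HP) L Hu Hv) as [c [_ Hc]]. now exists c.
  - assert (L' : v < u) by (destruct L; [lra | subst; lra]).
    pose proof (degree_le_scal n (-1) P HP) as HQ.
    destruct (IVT _ v u (C _ HQ) L') as [c [_ Hc]]; [simpl; lra | simpl; lra |].
    exists c. lra.
Qed.

Lemma Rbar_lt_radius (a : nat -> R) (x : R) :
  Rbar_le 1 (CV_radius a) -> Rabs x < 1 -> Rbar_lt (Rabs x) (CV_radius a).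
Proof. intros H1 H2. apply Rbar_lt_le_trans with 1; [exact H2 | exact H1]. Qed.

Lemma radius_scal_ge (c : R) (a : nat -> R) :
  Rbar_le 1 (CV_radius a) -> Rbar_le 1 (CV_radius (PS_scal c a)).
Proof.
  intros H1. destruct (Req_dec c 0) as [E|E].
  - rewrite (CV_radius_ext _ (fun _ => 0)).
    + rewrite CV_radius_const_0. exact I.
    + intros n. unfold PS_scal, scal; simpl; unfold mult; simpl. rewrite E; ring.
  - rewrite CV_radius_scal by exact E. exact H1.
Qed.

Lemma radius_plus_ge (a b : nat -> R) :
  Rbar_le 1 (CV_radius a) -> Rbar_le 1 (CV_radius b) ->
  Rbar_le 1 (CV_radius (PS_plus a b)).
Proof.
  intros H1 H2. eapply Rbar_le_trans; [|apply CV_radius_plus].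
  apply Rbar_min_case; assumption.
Qed.

(* Coefficients of z f'(z) - al f(z), where f has coefficients a. *)
Definition euler_shift (al : R) (a : nat -> R) : nat -> R :=
  PS_plus (PS_incr_1 (PS_derive a)) (PS_scal (- al) a).

Lemma euler_shift_coef (al : R) (a : nat -> R) (k : nat) :
  euler_shift al a k = (INR k - al) * a k.
Proof.
  unfold euler_shift, PS_plus, PS_incr_1, PS_scal, PS_derive, plus, scal, mult; simpl.
  unfold mult, zero; simpl. destruct k; simpl; ring.
Qed.

Lemma euler_shift_radius (al : R) (a : nat -> R) :
  Rbar_le 1 (CV_radius a) -> Rbar_le 1 (CV_radius (euler_shift al a)).
Proof.
  intros H1. apply radius_plus_ge; [|now apply radius_scal_ge].
  rewrite CV_radius_incr_1, CV_radius_derive. exact H1.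
Qed.

(** Leibniz's rule for the j-th derivative of z f' - al f, where only one derivative of the factor z
    survives. It shows that the operator lowers the order of a zero by at most one. *)
Lemma euler_shift_derive_n (al : R) (a : nat -> R) (j : nat) (x : R) :
  Rbar_le 1 (CV_radius a) -> Rabs x < 1 ->
  PSeries (PS_derive_n j (euler_shift al a)) x =
  x * PSeries (PS_derive_n (S j) a) x
  + (INR j - al) * PSeries (PS_derive_n j a) x.
Proof.
  intros H1 Hx.
  rewrite <- PSeries_incr_1, <- PSeries_scal, <- PSeries_plus.
  - apply PSeries_ext. intros k. unfold PS_derive_n at 1. rewrite euler_shift_coef.
    unfold PS_plus, PS_incr_1, PS_scal, PS_derive_n, plus, scal; simpl; unfold mult; simpl.
    destruct k as [|k].
    + unfold zero; simpl. ring.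
    + replace (S k + j)%nat with (k + S j)%nat by lia.
      rewrite plus_INR, S_INR.
      replace (Factorial.fact (S k)) with (S k * Factorial.fact k)%nat by reflexivity.
      rewrite mult_INR, S_INR.
      pose proof (INR_fact_neq_0 k). pose proof (pos_INR k).
      field. split; [assumption | lra].
  - apply CV_radius_inside, Rbar_lt_radius; [|exact Hx].
    now rewrite CV_radius_incr_1, CV_radius_derive_n.
  - apply CV_radius_inside, Rbar_lt_radius; [|exact Hx].
    apply radius_scal_ge. now rewrite CV_radius_derive_n.
Qed.

(** Formal derivatives are used instead of [Derive_n]: inside the disk of convergence they agree,
    and statements about them reduce to identities between coefficients. *)
Definition vanishes_to_order (a : nat -> R) (h : R) (k : nat) : Prop :=
  forall j, (j < k)%nat -> PSeries (PS_derive_n j a) h = 0.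

Lemma vanishes_value (a : nat -> R) (h : R) (k : nat) :
  vanishes_to_order a h (S k) -> PSeries a h = 0.
Proof.
  intros V. rewrite <- (V 0%nat ltac:(lia)). apply PSeries_ext. intros n.
  unfold PS_derive_n. rewrite Nat.add_0_r. field. apply INR_fact_neq_0.
Qed.

Lemma euler_shift_vanishes (al : R) (a : nat -> R) (h : R) (k : nat) :
  Rbar_le 1 (CV_radius a) -> Rabs h < 1 -> vanishes_to_order a h (S k) ->
  vanishes_to_order (euler_shift al a) h k.
Proof.
  intros H1 Hh V j Hj.
  rewrite euler_shift_derive_n, !V by (assumption || lia). ring.
Qed.

(** The points are kept in increasing order so that Rolle's theorem applies between neighbours. An
    entry with k = 0 claims nothing and counts for nothing. *)
Fixpoint zeros_from (a : nat -> R) (lo : R) (l : list (R * nat)) : Prop :=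
  match l with
  | nil => True
  | (h, k) :: l' => lo < h < 1 /\ vanishes_to_order a h k /\ zeros_from a h l'
  end.

Lemma zeros_from_lower (a : nat -> R) (lo lo' : R) (l : list (R * nat)) :
  lo' <= lo -> zeros_from a lo l -> zeros_from a lo' l.
Proof.
  destruct l as [|[h k] l]; simpl; [auto|].
  intros L [H1 [H2 H3]]. repeat split; try assumption; lra.
Qed.

Lemma zeros_from_insert (a : nat -> R) (h : R) (k : nat) (l : list (R * nat)) (lo : R) :
  lo < h < 1 -> vanishes_to_order a h k -> ~ In h (map fst l) -> zeros_from a lo l ->
  exists l', zeros_from a lo l' /\
    list_sum (map snd l') = (k + list_sum (map snd l))%nat /\
    forall u, In u (map fst l') <-> u = h \/ In u (map fst l).
Proof.
  intros Hh V. revert lo Hh. induction l as [|[h1 k1] l IH]; intros lo Hh N Z.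
  - exists ((h, k) :: nil). simpl. split; [|split; [reflexivity|]].
    + repeat split; [lra | lra | exact V].
    + intros u. intuition.
  - simpl in N, Z. destruct Z as [H1 [V1 Z]].
    destruct (Rlt_le_dec h h1) as [L|L].
    + exists ((h, k) :: (h1, k1) :: l). simpl.
      split; [|split; [reflexivity | intros; intuition]].
      repeat split; try assumption; lra.
    + assert (h1 <> h) by tauto.
      destruct (IH h1) as [l' [Z' [E' I']]]; [lra | tauto | exact Z |].
      exists ((h1, k1) :: l'). simpl. split; [|split].
      * repeat split; try assumption; lra.
      * rewrite E'. lia.
      * intros u. rewrite I'. intuition.
Qed.

Lemma zeros_from_sort (a : nat -> R) (l : list (R * nat)) :
  NoDup (map fst l) ->
  (forall h k, In (h, k) l -> 0 < h < 1 /\ vanishes_to_order a h k) ->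
  exists l', zeros_from a 0 l' /\ list_sum (map snd l') = list_sum (map snd l).
Proof.
  intros ND Hl.
  (* The induction also has to carry the set of points, to know that the next one inserted is
     new. *)
  enough (exists l', zeros_from a 0 l' /\ list_sum (map snd l') = list_sum (map snd l)
    /\ forall u, In u (map fst l') <-> In u (map fst l)) by firstorder.
  induction l as [|[h k] l IH].
  - exists nil. simpl. tauto.
  - simpl in ND. apply NoDup_cons_iff in ND. destruct ND as [N ND].
    destruct IH as [l1 [Z1 [E1 I1]]]; [exact ND | intros; apply Hl; now right |].
    destruct (Hl h k (or_introl eq_refl)) as [Hh V].
    destruct (zeros_from_insert a h k l1 0) as [l2 [Z2 [E2 I2]]];
      [exact Hh | exact V | now rewrite I1 | exact Z1 |].
    exists l2. split; [exact Z2|]. split.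
    + simpl. congruence.
    + intros u. rewrite I2, I1. simpl. intuition.
Qed.

(** This is (z^(-al) f)' = z^(-al-1) (z f' - al f). For z > 0 the twisted function has the zeros of
    f, and its critical points are the zeros of the shifted series. *)
Lemma is_derive_twisted (al : R) (a : nat -> R) (z : R) :
  Rbar_le 1 (CV_radius a) -> 0 < z < 1 ->
  is_derive (fun u => Rpower u (- al) * PSeries a u) z
    (Rpower z (- al) * (/ z * PSeries (euler_shift al a) z)).
Proof.
  intros H1 Hz.
  assert (Az : Rabs z < 1) by (rewrite Rabs_pos_eq; lra).
  assert (E : PSeries (euler_shift al a) z = z * PSeries (PS_derive a) z - al * PSeries a z).
  { unfold euler_shift. rewrite PSeries_plus.
    - rewrite PSeries_incr_1, PSeries_scal. ring.
    - apply CV_radius_inside, Rbar_lt_radius; [|exact Az].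
      now rewrite CV_radius_incr_1, CV_radius_derive.
    - apply CV_radius_inside, Rbar_lt_radius; [|exact Az]. now apply radius_scal_ge. }
  rewrite E.
  pose proof (is_derive_PSeries a z (Rbar_lt_radius a z H1 Az)) as D.
  assert (DP : is_derive (fun u => Rpower u (- al)) z (Rpower z (- al) * (- al / z))).
  { unfold Rpower. auto_derive; [lra|]. field. lra. }
  pose proof (is_derive_mult _ _ z _ _ DP D Rmult_comm) as DD.
  unfold plus, mult in DD; simpl in DD.
  replace (Rpower z (- al) * (/ z * (z * PSeries (PS_derive a) z - al * PSeries a z)))
    with (Rpower z (- al) * (- al / z) * PSeries a z + Rpower z (- al) * PSeries (PS_derive a) z)
    by (field; lra).
  exact DD.
Qed.

Lemma euler_shift_rolle (al : R) (a : nat -> R) (u v : R) :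
  Rbar_le 1 (CV_radius a) -> 0 < u -> u < v -> v < 1 ->
  PSeries a u = 0 -> PSeries a v = 0 ->
  exists c, u < c < v /\ PSeries (euler_shift al a) c = 0.
Proof.
  intros H1 Hu Huv Hv Eu Ev.
  destruct (MVT_cor2 (fun z => Rpower z (- al) * PSeries a z)
    (fun z => Rpower z (- al) * (/ z * PSeries (euler_shift al a) z)) u v Huv)
    as [c [Ec Hc]].
  - intros c Hc. apply is_derive_Reals, is_derive_twisted; [exact H1 | lra].
  - exists c. split; [exact Hc|]. cbv beta in Ec. rewrite Eu, Ev in Ec.
    assert (0 < Rpower c (- al)) by apply exp_pos.
    assert (0 < / c) by (apply Rinv_0_lt_compat; lra).
    assert (0 < Rpower c (- al) * / c * (v - u)) by (repeat apply Rmult_lt_0_compat; lra).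
    apply Rmult_eq_reg_l with (Rpower c (- al) * / c * (v - u)); lra.
Qed.

(** A zero of order k + 1 keeps order k, and Rolle's theorem supplies one new zero in the gap to the
    preceding zero. As [h] is itself a zero, every entry of positive multiplicity has such a gap,
    and the total is unchanged. *)
Lemma rolle_tail (al : R) (a : nat -> R) (l : list (R * nat)) (h : R) :
  Rbar_le 1 (CV_radius a) -> 0 < h -> PSeries a h = 0 -> zeros_from a h l ->
  exists l', zeros_from (euler_shift al a) h l' /\
    list_sum (map snd l') = list_sum (map snd l).
Proof.
  intros H1. revert h. induction l as [|[h1 [|k1]] l IH]; intros h Hh Eh Z.
  - exists nil. now simpl.
  - destruct Z as [L1 [_ Z]]. apply IH; [assumption | assumption |].
    apply zeros_from_lower with h1; [lra | exact Z].
  - destruct Z as [L1 [V1 Z]].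
    pose proof (vanishes_value _ _ _ V1) as E1.
    destruct (IH h1) as [l' [Z' S']]; [lra | exact E1 | exact Z |].
    destruct (euler_shift_rolle al a h h1 H1) as [c [Hc Ec]]; [lra .. | exact Eh | exact E1 |].
    exists ((c, 1%nat) :: (h1, k1) :: l'). simpl. split.
    + repeat split; try lra; [| | exact Z'].
      * intros j Hj. replace j with 0%nat by lia. rewrite <- Ec. apply PSeries_ext.
        intros n. unfold PS_derive_n. rewrite Nat.add_0_r. field. apply INR_fact_neq_0.
      * apply euler_shift_vanishes; [exact H1 | rewrite Rabs_pos_eq; lra | exact V1].
    + rewrite S'. reflexivity.
Qed.

(** Only the first genuine zero has no zero to its left, so it alone loses one unit of multiplicity;
    [rolle_tail] takes care of the others. *)
Lemma rolle_count (al : R) (a : nat -> R) (l : list (R * nat)) (lo : R) :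
  Rbar_le 1 (CV_radius a) -> 0 <= lo -> zeros_from a lo l ->
  exists l', zeros_from (euler_shift al a) lo l' /\
    (list_sum (map snd l) <= S (list_sum (map snd l')))%nat.
Proof.
  intros H1. revert lo. induction l as [|[h [|k]] l IH]; intros lo Hlo Z.
  - exists nil. simpl. auto.
  - destruct Z as [L1 [_ Z]]. apply IH; [assumption |].
    apply zeros_from_lower with h; [lra | exact Z].
  - destruct Z as [L1 [V1 Z]].
    destruct (rolle_tail al a l h) as [l' [Z' S']];
      [exact H1 | lra | eapply vanishes_value, V1 | exact Z |].
    exists ((h, k) :: l'). simpl. split.
    + repeat split; try lra; [| exact Z'].
      apply euler_shift_vanishes; [exact H1 | rewrite Rabs_pos_eq; lra | exact V1].
    + rewrite S'. lia.
Qed.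

Lemma nonvanishing_no_zeros (a : nat -> R) (l : list (R * nat)) (lo : R) :
  (forall x, lo < x < 1 -> PSeries a x <> 0) -> zeros_from a lo l ->
  list_sum (map snd l) = 0%nat.
Proof.
  revert lo. induction l as [|[h [|k]] l IH]; simpl; intros lo N Z; [reflexivity| |].
  - apply IH with h; [intros; apply N; lra | apply Z].
  - exfalso. destruct Z as [L [V _]]. apply (N h L). eapply vanishes_value, V.
Qed.

(** The point [x0] excludes the zero series. Some coefficient is then positive, and the increasing
    partial sums stay above the first one that contains it. *)
Lemma PSeries_nonneg_pos (a : nat -> R) (x0 x : R) :
  Rbar_le 1 (CV_radius a) -> (forall k, 0 <= a k) ->
  PSeries a x0 <> 0 -> 0 < x < 1 -> 0 < PSeries a x.
Proof.
  intros H1 Ha N Hx.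
  destruct (Classical_Prop.classic (exists k, a k <> 0)) as [[k Hk]|E].
  - assert (T : forall n, 0 <= a n * x ^ n).
    { intros n. apply Rmult_le_pos; [apply Ha | apply pow_le; lra]. }
    assert (Hk' : 0 < a k * x ^ k).
    { apply Rmult_lt_0_compat; [specialize (Ha k); lra | apply pow_lt; lra]. }
    assert (ES : ex_series (fun n => a n * x ^ n)).
    { apply ex_pseries_R, CV_radius_inside, Rbar_lt_radius;
        [exact H1 | rewrite Rabs_pos_eq; lra]. }
    apply Series_correct in ES.
    apply Rlt_le_trans with (sum_n (fun n => a n * x ^ n) k).
    + destruct k as [|k]; [rewrite sum_O; exact Hk'|].
      rewrite sum_Sn. unfold plus; simpl.
      assert (0 <= sum_n (fun n => a n * x ^ n) k); [|simpl in Hk'; lra].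
      rewrite sum_n_Reals. now apply cond_pos_sum.
    + apply (is_lim_seq_incr_compare (sum_n (fun n => a n * x ^ n))); [exact ES|].
      intros n. rewrite sum_Sn. unfold plus; simpl. specialize (T (S n)). simpl in T. lra.
  - exfalso. apply N. rewrite (PSeries_ext _ (fun _ => 0)); [apply PSeries_const_0|].
    intros n. destruct (Req_dec (a n) 0) as [E0|E0]; [exact E0 | exfalso; eauto].
Qed.

Lemma PSeries_one_signed (a : nat -> R) (x0 x : R) :
  Rbar_le 1 (CV_radius a) -> (forall k, 0 <= a k) \/ (forall k, a k <= 0) ->
  PSeries a x0 <> 0 -> 0 < x < 1 -> PSeries a x <> 0.
Proof.
  intros H1 [Ha|Ha] N Hx.
  - apply Rgt_not_eq. now apply PSeries_nonneg_pos with x0.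
  - assert (P : 0 < PSeries (PS_scal (-1) a) x).
    { apply PSeries_nonneg_pos with x0; [now apply radius_scal_ge | | | exact Hx].
      - intros k. unfold PS_scal, scal; simpl; unfold mult; simpl. specialize (Ha k). lra.
      - rewrite PSeries_scal. lra. }
    rewrite PSeries_scal in P. lra.
Qed.

(* Descartes' rule for power series whose coefficients change sign with a
   polynomial S in the index: applying z d/dz - c at a root c of S replaces
   S(k) = (k - c) S1(k) by S1(k) and the weights e(k) by e(k)(k - c)^2, and by
   Rolle's theorem loses at most one zero. *)
Lemma descartes_polynomial (n : nat) (S : R -> R) (e a : nat -> R)
    (x0 : R) (l : list (R * nat)) :
  degree_le n S -> (forall k, 0 <= e k) -> (forall k, a k = e k * S (INR k)) ->
  Rbar_le 1 (CV_radius a) -> 0 < x0 < 1 -> PSeries a x0 <> 0 ->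
  zeros_from a 0 l -> (list_sum (map snd l) <= n)%nat.
Proof.
  revert S e a x0 l. induction n as [|n IH]; intros S e a x0 l DS He Ea H1 Hx0 N Z.
  - rewrite (nonvanishing_no_zeros a l 0); [lia | | exact Z].
    intros x Hx. apply PSeries_one_signed with x0; try assumption.
    destruct (Rle_dec 0 (S 0)); [left | right]; intros k; rewrite Ea, (DS (INR k) 0);
      specialize (He k); nra.
  (* Unless [S] takes both signs at indices, the coefficients are one-signed and there is no zero at
     all. If it does, it has a real root, which need not be an index. *)
  - destruct (Classical_Prop.classic (exists u, S (INR u) < 0)) as [[u Hu]|A].
    2:{ rewrite (nonvanishing_no_zeros a l 0); [lia | | exact Z].
        intros x Hx. apply PSeries_one_signed with x0; try assumption.
        left. intros k. rewrite Ea. apply Rmult_le_pos; [apply He|].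
        destruct (Rlt_le_dec (S (INR k)) 0); [exfalso; eauto | assumption]. }
    destruct (Classical_Prop.classic (exists v, 0 < S (INR v))) as [[v Hv]|A].
    2:{ rewrite (nonvanishing_no_zeros a l 0); [lia | | exact Z].
        intros x Hx. apply PSeries_one_signed with x0; try assumption.
        right. intros k. rewrite Ea. specialize (He k).
        destruct (Rlt_le_dec 0 (S (INR k))); [exfalso; eauto | nra]. }
    destruct (degree_le_root _ S _ _ DS Hu Hv) as [c Hc].
    destruct (DS c) as [S1 [DS1 ES]].
    (* The induction hypothesis needs a point where the shifted series does not vanish, so the case
       of a series killed by the operator is treated apart. *)
    destruct (Classical_Prop.classic
      (exists x, 0 < x < 1 /\ PSeries (euler_shift c a) x <> 0)) as [[x1 [Hx1 N1]]|A].
    + destruct (rolle_count c a l 0 H1 (Rle_refl 0) Z) as [l' [Z' L']].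
      enough (list_sum (map snd l') <= n)%nat by lia.
      apply (IH S1 (fun k => e k * (INR k - c) ^ 2) (euler_shift c a) x1);
        try assumption; [| | now apply euler_shift_radius].
      * intros k. apply Rmult_le_pos; [apply He | apply pow2_ge_0].
      * intros k. rewrite euler_shift_coef, Ea, ES, Hc. ring.
    + (* Here z^(-c) times the series is constant. *)
      rewrite (nonvanishing_no_zeros a l 0); [lia | | exact Z].
      assert (W : forall u v, 0 < u -> u < v -> v < 1 ->
        Rpower v (- c) * PSeries a v = Rpower u (- c) * PSeries a u).
      { intros u' v' Hu' Huv Hv'.
        destruct (MVT_cor2 (fun z => Rpower z (- c) * PSeries a z)
          (fun z => Rpower z (- c) * (/ z * PSeries (euler_shift c a) z)) u' v' Huv)
          as [m [Em Hm]].
        - intros w Hw. apply is_derive_Reals, is_derive_twisted; [exact H1 | lra].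
        - destruct (Req_dec (PSeries (euler_shift c a) m) 0) as [E0|E0].
          + rewrite E0 in Em. lra.
          + exfalso. apply A. exists m. split; [lra | exact E0]. }
      intros x Hx E0.
      assert (P0 : 0 < Rpower x0 (- c)) by apply exp_pos.
      assert (P0x : Rpower x0 (- c) * PSeries a x0 <> 0)
        by (apply Rmult_integral_contrapositive_currified; [lra | exact N]).
      destruct (Rtotal_order x x0) as [L|[L|L]].
      * specialize (W x x0 (proj1 Hx) L (proj2 Hx0)). rewrite E0 in W. lra.
      * subst x. contradiction.
      * specialize (W x0 x (proj1 Hx0) L (proj2 Hx)). rewrite E0 in W. lra.
Qed.

(** * Half-integer binomial series averaged over a circle *)

(** The terms of a convergent series tend to 0 and are therefore bounded, which puts every z < 1
    below the radius. *)
Lemma radius_ge_one (a : nat -> R) :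
  (forall z, 0 < z < 1 -> ex_pseries a z) -> Rbar_le 1 (CV_radius a).
Proof.
  intros Hz.
  assert (L : forall z, 0 < z < 1 -> Rbar_le z (CV_radius a)).
  { intros z H1. apply (proj1 (CV_radius_bounded a)).
    destruct (proj1 (ex_pseries_R a z) (Hz z H1)) as [l Hl].
    destruct (ex_series_lim_0 _ (ex_intro _ l Hl) (ball 0 (mkposreal 1 Rlt_0_1))
      (locally_ball _ _)) as [N HN].
    assert (B : forall m, exists M, forall n, (n < m)%nat -> Rabs (a n * z ^ n) <= M).
    { induction m as [|m [M HM]]; [exists 0; intros; lia|].
      exists (Rmax M (Rabs (a m * z ^ m))). intros n Hn.
      destruct (Nat.eq_dec n m) as [->|E]; [apply Rmax_r|].
      eapply Rle_trans; [apply HM; lia | apply Rmax_l]. }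
    destruct (B N) as [M HM]. exists (Rmax M 1). intros n.
    destruct (Nat.lt_ge_cases n N) as [C|C].
    - eapply Rle_trans; [now apply HM | apply Rmax_l].
    - specialize (HN n C). unfold ball in HN; simpl in HN.
      unfold AbsRing_ball, abs, minus, plus, opp in HN; simpl in HN.
      rewrite Ropp_0, Rplus_0_r in HN. eapply Rle_trans; [left; exact HN | apply Rmax_r]. }
  destruct (CV_radius a) as [c| |]; simpl in *.
  - destruct (Rle_lt_dec 1 c) as [C|C]; [exact C|].
    (* A test point strictly between [c] and 1; the maximum with 1/2 keeps it positive whatever the
       sign of [c]. *)
    assert (0 < Rmax (1 / 2) ((1 + c) / 2) < 1) by (split; [apply Rlt_le_trans with (1/2);
      [lra | apply Rmax_l] | apply Rmax_lub_lt; lra]).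
    specialize (L _ H). pose proof (Rmax_r (1 / 2) ((1 + c) / 2)). lra.
  - exact I.
  - apply (L (1 / 2)). lra.
Qed.

Fixpoint binomial_coef (b : R) (k : nat) : R :=
  match k with
  | O => 1
  | S m => binomial_coef b m * ((b - INR m) / INR (S m))
  end.

Lemma binomial_coef_neq_0 (b : R) (n : nat) :
  (forall k, b <> INR k) -> binomial_coef b n <> 0.
Proof.
  intros Hb. induction n as [|n IH]; cbn [binomial_coef]; [lra|].
  apply Rmult_integral_contrapositive_currified; [exact IH|].
  apply Rmult_integral_contrapositive_currified; [specialize (Hb n); lra|].
  apply Rinv_neq_0_compat. apply (not_0_INR (S n)). lia.
Qed.

Lemma binomial_coef_radius (b : R) :
  (forall k, b <> INR k) -> Rbar_le 1 (CV_radius (binomial_coef b)).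
Proof.
  intros Hb. rewrite (CV_radius_finite_DAlembert _ 1).
  - rewrite Rinv_1. simpl. lra.
  - intros n. now apply binomial_coef_neq_0.
  - lra.
  (* The ratio (b - n)/(n + 1) equals (b + 1)/(n + 1) - 1, which tends to -1. *)
  - apply is_lim_seq_ext with (fun n => Rabs ((b + 1) * / INR (S n) - 1)).
    { intros n. f_equal. cbn [binomial_coef].
      assert (INR (S n) <> 0) by (apply not_0_INR; lia).
      field_simplify_eq; [rewrite S_INR; ring | split; [assumption | now apply binomial_coef_neq_0]]. }
    replace (Finite 1) with (Rbar_abs (Finite ((b + 1) * 0 - 1))).
    2:{ simpl. f_equal. rewrite Rabs_left; lra. }
    apply is_lim_seq_abs. apply is_lim_seq_minus'; [|apply is_lim_seq_const].
    apply (is_lim_seq_scal_l _ (b + 1) 0).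
    apply (is_lim_seq_incr_1 (fun n => / INR n)).
    replace (Finite 0) with (Rbar_inv p_infty) by reflexivity.
    apply is_lim_seq_inv; [apply is_lim_seq_INR | discriminate].
Qed.

(** The sum f satisfies (1 + z) f' = b f, so (1 + z)^(-b) f has derivative 0 on the unit interval
    around 0 and keeps its value 1 at z = 0. *)
Lemma binomial_series (b y : R) :
  (forall k, b <> INR k) -> Rabs y < 1 ->
  PSeries (binomial_coef b) y = Rpower (1 + y) b.
Proof.
  intros Hb Hy. pose proof (binomial_coef_radius b Hb) as H1.
  set (f := PSeries (binomial_coef b)).
  assert (D : forall z, Rabs z < 1 ->
    is_derive (fun u => Rpower (1 + u) (- b) * f u) z 0).
  { intros z Hz. apply Rabs_def2 in Hz as Hz'.
    pose proof (Rbar_lt_radius _ _ H1 Hz) as Hr.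
    pose proof (is_derive_PSeries _ _ Hr) as Df. fold f in Df.
    set (f' := PSeries (PS_derive (binomial_coef b)) z) in *.
    assert (E : f' + z * f' = b * f z).
    { unfold f', f. rewrite <- PSeries_incr_1, <- PSeries_scal, <- PSeries_plus.
      - apply PSeries_ext. intros n.
        unfold PS_plus, PS_incr_1, PS_derive, PS_scal, plus, scal; simpl; unfold mult.
        cbn -[INR binomial_coef].
        destruct n as [|n].
        + unfold zero; simpl. field.
        + change (INR (S (S n)) * binomial_coef b (S (S n))
            + INR (S n) * binomial_coef b (S n) = b * binomial_coef b (S n)).
          cbn [binomial_coef]. pose proof (pos_INR n). rewrite !S_INR. field. lra.
      - apply CV_radius_inside. now rewrite CV_radius_derive.
      - apply CV_radius_inside. now rewrite CV_radius_incr_1, CV_radius_derive. }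
    assert (DP : is_derive (fun u => Rpower (1 + u) (- b)) z
      (Rpower (1 + z) (- b) * (- b / (1 + z)))).
    { unfold Rpower. auto_derive; [lra|]. field. lra. }
    pose proof (is_derive_mult _ _ z _ _ DP Df Rmult_comm) as DD.
    unfold plus, mult in DD; simpl in DD.
    replace 0 with (Rpower (1 + z) (- b) * (- b / (1 + z)) * f z
      + Rpower (1 + z) (- b) * f'); [exact DD|].
    replace (f z * b) with (b * f z) by ring.
    transitivity (Rpower (1 + z) (- b) / (1 + z) * (f' + z * f' - b * f z));
      [field; lra | rewrite E; ring]. }
  apply Rabs_def2 in Hy as Hy'.
  assert (E : Rpower (1 + y) (- b) * f y = Rpower (1 + 0) (- b) * f 0).
  { destruct (Rtotal_order y 0) as [L|[->|L]]; [| reflexivity |].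
    - apply (eq_is_derive (fun u => Rpower (1 + u) (- b) * f u)); [|exact L].
      intros t Ht. apply D, Rabs_def1; lra.
    - symmetry. apply (eq_is_derive (fun u => Rpower (1 + u) (- b) * f u)); [|exact L].
      intros t Ht. apply D, Rabs_def1; lra. }
  replace (f 0) with 1 in E by (unfold f; now rewrite PSeries_0).
  unfold Rpower at 2 in E. rewrite Rplus_0_r, ln_1, Rmult_0_r, exp_0 in E.
  rewrite Rpower_Ropp in E.
  assert (0 < Rpower (1 + y) b) by apply exp_pos.
  apply Rmult_eq_reg_l with (/ Rpower (1 + y) b); [|apply Rinv_neq_0_compat; lra].
  rewrite E, Rinv_l; lra.
Qed.

Lemma RInt_sum_n (f : nat -> R -> R) (a b : R) (N : nat) :
  (forall k, ex_RInt (f k) a b) ->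
  is_RInt (fun t => sum_n (fun k => f k t) N) a b (sum_n (fun k => RInt (f k) a b) N).
Proof.
  intros Hf. induction N as [|N IH].
  - rewrite sum_O. apply is_RInt_ext with (f 0%nat); [intros; now rewrite sum_O|].
    apply (RInt_correct (V := R_CompleteNormedModule)), Hf.
  - rewrite sum_Sn.
    apply is_RInt_ext with (fun t => plus (sum_n (fun k => f k t) N) (f (S N) t)).
    + intros. now rewrite sum_Sn.
    + apply (is_RInt_plus (V := R_NormedModule)); [exact IH | apply (RInt_correct (V := R_CompleteNormedModule)), Hf].
Qed.

(** Weierstrass's test: the remainder after N terms is bounded uniformly in t by the tail of [M],
    hence its integral by b - a times that tail. *)
Lemma is_series_RInt (f : nat -> R -> R) (F : R -> R) (M : nat -> R) (a b : R) :
  a <= b -> (forall k, ex_RInt (f k) a b) -> ex_RInt F a b ->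
  (forall k t, a <= t <= b -> Rabs (f k t) <= M k) -> ex_series M ->
  (forall t, a <= t <= b -> is_series (fun k => f k t) (F t)) ->
  is_series (fun k => RInt (f k) a b) (RInt F a b).
Proof.
  intros Hab Hf HF HM EM HS.
  assert (B : forall N, Rabs (RInt F a b - sum_n (fun k => RInt (f k) a b) N)
    <= (b - a) * (Series M - sum_n M N)).
  { intros N.
    rewrite <- (is_RInt_unique _ _ _ _ (RInt_sum_n f a b N Hf)).
    assert (EN : ex_RInt (fun t => sum_n (fun k => f k t) N) a b)
      by (eexists; apply (RInt_sum_n f a b N Hf)).
    pose proof (RInt_minus F (fun t => sum_n (fun k => f k t) N) a b HF EN) as EE.
    unfold minus, plus, opp in EE; simpl in EE. unfold Rminus at 1. rewrite <- EE.
    apply abs_RInt_le_const; [exact Hab | apply (ex_RInt_minus (V := R_NormedModule)); assumption |].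
    intros t Ht.
    assert (ES : ex_series (fun k => Rabs (f k t))).
    { apply (ex_series_le (K := R_AbsRing) (V := R_CompleteNormedModule) _ M);
        [|exact EM].
      intros k. unfold norm; simpl. unfold abs; simpl. rewrite Rabs_Rabsolu. now apply HM. }
    rewrite <- (is_series_unique _ _ (HS t Ht)).
    rewrite (Series_incr_n (fun k => f k t) (S N)), (Series_incr_n M (S N));
      try lia; [| exact EM | now apply ex_series_Rabs].
    simpl pred. rewrite !sum_n_Reals.
    match goal with |- Rabs (?x + ?y + - ?x) <= ?u + ?v - ?u =>
      replace (x + y + - x) with y by ring; replace (u + v - u) with v by ring end.
    eapply Rle_trans; [apply Series_Rabs|].
    - now apply (ex_series_incr_n (fun k => Rabs (f k t)) (S N)).
    - apply Series_le; [|now apply ex_series_incr_n].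
      intros n. split; [apply Rabs_pos | now apply HM]. }
  assert (LT : is_lim_seq (fun N => (b - a) * (Series M - sum_n M N)) 0).
  { replace (Finite 0) with (Rbar_mult (b - a) (Series M - Series M))
      by (simpl; f_equal; ring).
    apply is_lim_seq_scal_l, is_lim_seq_minus'; [apply is_lim_seq_const|].
    now apply Series_correct. }
  change (is_lim_seq (sum_n (fun k => RInt (f k) a b)) (RInt F a b)).
  apply is_lim_seq_le_le with
    (fun N => RInt F a b - (b - a) * (Series M - sum_n M N))
    (fun N => RInt F a b + (b - a) * (Series M - sum_n M N)).
  - intros N. specialize (B N). apply Rabs_le_between in B. lra.
  - replace (Finite (RInt F a b)) with (Finite (RInt F a b - 0)) by (f_equal; ring).
    apply is_lim_seq_minus'; [apply is_lim_seq_const | exact LT].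
  - replace (Finite (RInt F a b)) with (Finite (RInt F a b + 0)) by (f_equal; ring).
    apply is_lim_seq_plus'; [apply is_lim_seq_const | exact LT].
Qed.

Lemma is_series_even (u : nat -> R) (l : R) :
  (forall k, u (2 * k + 1)%nat = 0) -> is_series u l ->
  is_series (fun k => u (2 * k)%nat) l.
Proof.
  intros Hu Hs.
  change (is_lim_seq (sum_n (fun k => u (2 * k)%nat)) l).
  apply is_lim_seq_ext with (fun N => sum_n u (2 * N)).
  - induction n as [|n IH]; [now rewrite !sum_O|].
    replace (2 * S n)%nat with (S (S (2 * n))) by lia.
    rewrite !sum_Sn, IH. replace (S (2 * n)) with (2 * n + 1)%nat by lia.
    rewrite Hu. unfold plus; simpl. replace (S (n + (n + 0) + 1))%nat with (S (n + S (n + 0)))%nat by lia. ring.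
  - apply (is_lim_seq_subseq (sum_n u) l (fun N => (2 * N)%nat)); [|exact Hs].
    apply eventually_subseq. intros; lia.
Qed.

Definition wallis (k : nat) : R := RInt (fun v => cos v ^ k * sin v ^ 2) 0 (2 * PI).

Lemma wallis_continuous (k : nat) (v : R) :
  continuous (fun v => cos v ^ k * sin v ^ 2) v.
Proof. apply (ex_derive_continuous (V := R_NormedModule)). auto_derive. auto. Qed.

Lemma wallis_ex (k : nat) (a b : R) : ex_RInt (fun v => cos v ^ k * sin v ^ 2) a b.
Proof. apply (ex_RInt_continuous (V := R_CompleteNormedModule)). intros; apply wallis_continuous. Qed.

Lemma wallis_even_nonneg (k : nat) : 0 <= wallis (2 * k).
Proof.
  pose proof PI_RGT_0. apply RInt_ge_0; [lra | apply wallis_ex |].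
  intros v _. rewrite pow_mult. apply Rmult_le_pos; [apply pow_le|]; apply pow2_ge_0.
Qed.

(** The shift of v by [PI] changes the sign of the integrand, so the two half turns cancel. *)
Lemma wallis_odd (k : nat) : wallis (2 * k + 1) = 0.
Proof.
  unfold wallis. set (f := fun v => cos v ^ (2 * k + 1) * sin v ^ 2).
  pose proof (RInt_Chasles f 0 PI (2 * PI) (wallis_ex _ _ _) (wallis_ex _ _ _)) as C.
  pose proof (RInt_comp_lin f 1 PI 0 PI (wallis_ex _ _ _)) as L.
  replace (1 * 0 + PI) with PI in L by ring.
  replace (1 * PI + PI) with (2 * PI) in L by ring.
  rewrite (RInt_ext _ (fun y => opp (f y))) in L.
  - pose proof (RInt_opp (V := R_CompleteNormedModule) f 0 PI (wallis_ex _ _ _)) as O.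
    unfold plus, opp in C, L, O; simpl in C, L, O. lra.
  - intros v _. unfold f, scal, opp; simpl; unfold mult; simpl.
    replace (1 * v + PI) with (v + PI) by ring. rewrite neg_cos, neg_sin.
    replace (k + (k + 0) + 1)%nat with (2 * k + 1)%nat by lia.
    rewrite !pow_add, !pow_mult, !pow_1.
    replace ((- cos v) ^ 2) with (cos v ^ 2) by ring. ring.
Qed.

Lemma RInt_scal_wallis (c : R) (k : nat) :
  RInt (fun v => c * (cos v ^ k * sin v ^ 2)) 0 (2 * PI) = c * wallis k.
Proof. exact (RInt_scal (V := R_CompleteNormedModule) _ _ _ c (wallis_ex _ _ _)). Qed.

(** The binomial series in s cos v is integrated term by term with the majorant |binom(b,k)| s^k.
    The odd terms vanish, so a series in s^2 remains. *)
Lemma Rpower_cos_series (b s : R) :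
  (forall k, b <> INR k) -> 0 < s < 1 ->
  is_pseries (fun k => binomial_coef b (2 * k) * wallis (2 * k)) (s ^ 2)
    (RInt (fun v => Rpower (1 + s * cos v) b * sin v ^ 2) 0 (2 * PI)).
Proof.
  intros Hb Hs. pose proof PI_RGT_0 as HPI.
  pose proof (binomial_coef_radius b Hb) as H1.
  assert (Sm : forall v, Rabs (s * cos v) <= s).
  { intros v. rewrite Rabs_mult, (Rabs_pos_eq s) by lra.
    assert (Rabs (cos v) <= 1) by (apply Rabs_le; apply COS_bound). nra. }
  apply is_pseries_R.
  apply is_series_ext with
    (fun k => RInt (fun v => (binomial_coef b (2 * k) * s ^ (2 * k)) *
       (cos v ^ (2 * k) * sin v ^ 2)) 0 (2 * PI)).
  { intros k. rewrite RInt_scal_wallis, <- pow_mult.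
    match goal with |- ?u = ?v => change (@eq R u v) end. ring. }
  apply (is_series_even (fun k => RInt (fun v => (binomial_coef b k * s ^ k) *
       (cos v ^ k * sin v ^ 2)) 0 (2 * PI))).
  { intros k. rewrite RInt_scal_wallis, wallis_odd. ring. }
  apply is_series_RInt with (fun k => Rabs (binomial_coef b k * s ^ k)).
  - lra.
  - intros k. apply (ex_RInt_scal (V := R_NormedModule)), wallis_ex.
  - apply (ex_RInt_continuous (V := R_CompleteNormedModule)). intros v _.
    apply (ex_derive_continuous (V := R_NormedModule)). unfold Rpower. auto_derive.
    specialize (Sm v). apply Rabs_le_between in Sm. lra.
  - intros k v _. rewrite Rabs_mult.
    assert (Rabs (cos v ^ k * sin v ^ 2) <= 1).
    { rewrite Rabs_mult, <- RPow_abs.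
      assert (0 <= Rabs (cos v) <= 1) by (split; [apply Rabs_pos | apply Rabs_le, COS_bound]).
      assert (Rabs (cos v) ^ k <= 1) by (rewrite <- (pow1 k); now apply pow_incr).
      assert (0 <= Rabs (cos v) ^ k) by now apply pow_le.
      assert (Rabs (sin v ^ 2) <= 1).
      { pose proof (SIN_bound v). apply Rabs_le. nra. }
      pose proof (Rabs_pos (sin v ^ 2)). nra. }
    pose proof (Rabs_pos (binomial_coef b k * s ^ k)). nra.
  - apply (CV_disk_inside _ s), Rbar_lt_radius; [exact H1 | rewrite Rabs_pos_eq; lra].
  - intros v _.
    assert (A : Rabs (s * cos v) < 1) by (specialize (Sm v); lra).
    rewrite <- (binomial_series b) by assumption.
    apply is_series_ext with (fun k => scal (sin v ^ 2) (binomial_coef b k * (s * cos v) ^ k)).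
    + intros k. unfold scal; simpl; unfold mult; simpl. rewrite Rpow_mult_distr. ring.
    + replace (PSeries (binomial_coef b) (s * cos v) * sin v ^ 2)
        with (scal (sin v ^ 2) (PSeries (binomial_coef b) (s * cos v)))
        by (unfold scal; simpl; unfold mult; simpl; ring).
      apply (is_series_scal (K := R_AbsRing) (V := R_NormedModule)). apply Series_correct, ex_pseries_R, CV_radius_inside.
      now apply Rbar_lt_radius.
Qed.

(** The source of the polynomials in the index: the quotient of the two coefficients is linear in
    k. *)
Lemma binomial_coef_pred (b : R) (k : nat) :
  b <> 0 -> binomial_coef (b - 1) k = binomial_coef b k * ((b - INR k) / b).
Proof.
  intros Hb. induction k as [|k IH]; cbn [binomial_coef].
  - simpl. field. exact Hb.
  - rewrite IH. assert (INR (S k) <> 0) by (apply not_0_INR; lia).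
    rewrite S_INR in *. field. split; assumption.
Qed.

(** Going from 2k to 2k + 2 multiplies by (3/2 - 2k)(1/2 - 2k) over a positive number; both factors
    are positive for k = 0 and both are negative for k >= 1. *)
Lemma binomial_coef_three_halves (k : nat) : 0 <= binomial_coef (3 / 2) (2 * k).
Proof.
  induction k as [|k IH]; [simpl; lra|].
  replace (2 * S k)%nat with (S (S (2 * k))) by lia. cbn [binomial_coef].
  assert (0 < INR (S (2 * k))) by (apply lt_0_INR; lia).
  assert (0 < INR (S (S (2 * k)))) by (apply lt_0_INR; lia).
  replace (binomial_coef (3 / 2) (2 * k) * ((3 / 2 - INR (2 * k)) / INR (S (2 * k)))
    * ((3 / 2 - INR (S (2 * k))) / INR (S (S (2 * k)))))
    with (binomial_coef (3 / 2) (2 * k) * ((3 / 2 - INR (2 * k)) * (3 / 2 - INR (S (2 * k))))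
      * / (INR (S (2 * k)) * INR (S (S (2 * k))))) by (field; split; lra).
  apply Rmult_le_pos; [apply Rmult_le_pos; [exact IH |] | left; apply Rinv_0_lt_compat, Rmult_lt_0_compat; assumption].
  rewrite S_INR, mult_INR. change (INR 2) with 2.
  destruct k as [|k]; [simpl; lra|]. rewrite S_INR. pose proof (pos_INR k). nra.
Qed.

(** * Parametrization of the orbits *)

Record oriented_orbit (h : R) (x y : R -> R) (tau T : R) : Prop := {
  level_range : -1 < h < 0;
  orbit_closed : closed_orbit h x y T;
  half_period : 0 < tau < T;
  upper_half : forall t, 0 < t < tau -> 0 < y t;
  lower_half : forall t, tau < t < T -> y t < 0
}.

Lemma continuous_ge_0 (f : R -> R) (c : R) :
  continuous f c -> (forall d, 0 < d -> exists t, Rabs (t - c) < d /\ 0 <= f t) ->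
  0 <= f c.
Proof.
  intros Cf Hf. destruct (Rle_lt_dec 0 (f c)) as [L|L]; [exact L|]. exfalso.
  assert (Lc : locally c (fun t => f t < 0)).
  { apply (Cf (fun z => z < 0)). apply (open_lt 0). exact L. }
  destruct Lc as [d Hd]. destruct (Hf d (cond_pos d)) as [t [Ht Pt]].
  specialize (Hd t Ht). lra.
Qed.

Lemma is_derive_continuous (f : R -> R) (t l : R) : is_derive f t l -> continuous f t.
Proof. intros D. apply (ex_derive_continuous (V := R_NormedModule)). now exists l. Qed.

Lemma orbit_y_continuous (h : R) (x y : R -> R) (tau T t : R) :
  oriented_orbit h x y tau T -> continuous y t.
Proof. intros O. eapply is_derive_continuous, flow_y, O. Qed.

(** By continuity [y 0] is a limit of positive values from the right; by periodicity it equals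
    [y T], a limit of negative values from the left. *)
Lemma orbit_y_start (h : R) (x y : R -> R) (tau T : R) :
  oriented_orbit h x y tau T -> y 0 = 0.
Proof.
  intros O. destruct (half_period _ _ _ _ _ O) as [H1 H2].
  apply Rle_antisym.
  - replace (y 0) with (y T).
    2:{ rewrite <- (Rplus_0_l T). apply (periodic _ _ _ _ (orbit_closed _ _ _ _ _ O)). }
    enough (0 <= - y T) by lra.
    apply (continuous_ge_0 (fun t => - y t)).
    + apply (continuous_opp (V := R_NormedModule)). eapply orbit_y_continuous, O.
    + intros d Hd. exists (T - Rmin d (T - tau) / 2).
      assert (0 < Rmin d (T - tau)) by (apply Rmin_pos; lra).
      pose proof (Rmin_l d (T - tau)). pose proof (Rmin_r d (T - tau)). split.
      * apply Rabs_def1; lra.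
      * enough (y (T - Rmin d (T - tau) / 2) < 0) by lra.
        apply (lower_half _ _ _ _ _ O). lra.
  - apply (continuous_ge_0 y); [eapply orbit_y_continuous, O|].
    intros d Hd. exists (Rmin d tau / 2).
    assert (0 < Rmin d tau) by (apply Rmin_pos; lra).
    pose proof (Rmin_l d tau). pose proof (Rmin_r d tau). split.
    + apply Rabs_def1; lra.
    + left. apply (upper_half _ _ _ _ _ O). lra.
Qed.

Lemma orbit_y_half (h : R) (x y : R -> R) (tau T : R) :
  oriented_orbit h x y tau T -> y tau = 0.
Proof.
  intros O. destruct (half_period _ _ _ _ _ O) as [H1 H2].
  apply Rle_antisym.
  - enough (0 <= - y tau) by lra.
    apply (continuous_ge_0 (fun t => - y t)).
    + apply (continuous_opp (V := R_NormedModule)). eapply orbit_y_continuous, O.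
    + intros d Hd. exists (tau + Rmin d (T - tau) / 2).
      assert (0 < Rmin d (T - tau)) by (apply Rmin_pos; lra).
      pose proof (Rmin_l d (T - tau)). pose proof (Rmin_r d (T - tau)). split.
      * apply Rabs_def1; lra.
      * enough (y (tau + Rmin d (T - tau) / 2) < 0) by lra.
        apply (lower_half _ _ _ _ _ O). lra.
  - apply (continuous_ge_0 y); [eapply orbit_y_continuous, O|].
    intros d Hd. exists (tau - Rmin d tau / 2).
    assert (0 < Rmin d tau) by (apply Rmin_pos; lra).
    pose proof (Rmin_l d tau). pose proof (Rmin_r d tau). split.
    + apply Rabs_def1; lra.
    + left. apply (upper_half _ _ _ _ _ O). lra.
Qed.

Lemma orbit_level (h : R) (x y : R -> R) (tau T t : R) :
  oriented_orbit h x y tau T -> y t ^ 2 = 2 * (h * x t ^ 3 + 2 * x t ^ 2 - x t).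
Proof.
  intros O. pose proof (on_level _ _ _ _ (orbit_closed _ _ _ _ _ O) t) as L.
  pose proof (x_pos _ _ _ _ (orbit_closed _ _ _ _ _ O) t) as P.
  unfold H in L. rewrite <- L. field. lra.
Qed.

Lemma Derive_eta (f : R -> R) (t l : R) : is_derive f t l -> Derive (fun u : R => f u) t = l.
Proof. intros D. exact (is_derive_unique f t l D). Qed.

Definition angular_speed (x : R -> R) (t : R) : R := sqrt (2 * x t).

Definition angle (x : R -> R) (t : R) : R := RInt (angular_speed x) 0 t.

Section Angle.

Context (h : R) (x y : R -> R) (tau T : R) (O : oriented_orbit h x y tau T).

Let s := sqrt (1 + h).
Let q := angular_speed x.
Let v := angle x.

Let s_range : 0 < s < 1.
Proof.
  destruct (level_range _ _ _ _ _ O) as [H1 H2]. unfold s. split.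
  - apply sqrt_lt_R0. lra.
  - rewrite <- sqrt_1 at 2. apply sqrt_lt_1; lra.
Qed.

Let s_sqr : s ^ 2 = 1 + h.
Proof.
  destruct (level_range _ _ _ _ _ O) as [H1 H2]. unfold s. rewrite pow2_sqrt; lra.
Qed.

Let xp t : 0 < x t.
Proof. apply (x_pos _ _ _ _ (orbit_closed _ _ _ _ _ O)). Qed.

Let dx t : is_derive x t (X0 (x t) (y t)).
Proof. apply (flow_x _ _ _ _ (orbit_closed _ _ _ _ _ O)). Qed.

Let dy t : is_derive y t (Y0 (x t) (y t)).
Proof. apply (flow_y _ _ _ _ (orbit_closed _ _ _ _ _ O)). Qed.

Let q_pos t : 0 < q t.
Proof. apply sqrt_lt_R0. specialize (xp t). lra. Qed.

Let x_of_q t : x t = q t * q t / 2.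
Proof. unfold q, angular_speed. rewrite sqrt_sqrt; [field | specialize (xp t); lra]. Qed.

Let dq t : is_derive q t (q t * y t / 2).
Proof.
  unfold q at 1, angular_speed. pose proof (xp t) as P. pose proof (dx t) as D.
  auto_derive.
  - split; [eexists; exact D | split; [lra | exact I]].
  - rewrite (Derive_eta _ _ _ D). unfold X0.
    change (sqrt (2 * x t)) with (q t). rewrite (x_of_q t).
    pose proof (q_pos t). field. lra.
Qed.

Lemma angle_derive t : is_derive v t (q t).
Proof.
  unfold v, angle. apply (is_derive_RInt (V := R_NormedModule) q _ 0 t).
  - apply filter_forall. intros u. apply (RInt_correct (V := R_CompleteNormedModule)).
    apply (ex_RInt_continuous (V := R_CompleteNormedModule)). intros w _.
    eapply is_derive_continuous, dq.
  - eapply is_derive_continuous, dq.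
Qed.

(** [C] and [S] turn out to be the cosine and the sine of the angle [v]. The level equation becomes
    C^2 + S^2 = 1, and the flow becomes dC/dv = -S, dS/dv = C. *)
Let C t := (/ x t - 1) / s.
Let S t := y t / (s * x t * q t).

Let dC t : is_derive C t (- S t * q t).
Proof.
  unfold C. pose proof (xp t) as P. pose proof (dx t) as D. pose proof s_range.
  auto_derive.
  - repeat split; [eexists; exact D | lra].
  - rewrite (Derive_eta _ _ _ D). unfold X0, S.
    pose proof (q_pos t). field. repeat split; lra.
Qed.

Let dS t : is_derive S t (C t * q t).
Proof.
  unfold S. pose proof (xp t) as P. pose proof (dx t) as D. pose proof (dy t) as D'.
  pose proof (dq t) as D''. pose proof s_range. pose proof (q_pos t) as Q.
  auto_derive.
  - repeat split; try (eexists; eassumption).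
    repeat apply Rmult_integral_contrapositive_currified; lra.
  - rewrite (Derive_eta _ _ _ D),
      (Derive_eta _ _ _ D'), (Derive_eta _ _ _ D'').
    unfold X0, Y0, C. rewrite (x_of_q t). field. split; lra.
Qed.

Let CS t : C t ^ 2 + S t ^ 2 = 1.
Proof.
  pose proof (xp t) as P. pose proof s_range. pose proof (q_pos t) as Q.
  pose proof (orbit_level _ _ _ _ _ t O) as L.
  replace (C t ^ 2 + S t ^ 2)
    with (((/ x t - 1) ^ 2 + y t ^ 2 / (x t ^ 2 * (q t * q t))) / s ^ 2)
    by (unfold C, S; field; repeat split; lra).
  replace (q t * q t) with (2 * x t) by (rewrite x_of_q; field).
  rewrite L, s_sqr. field. destruct (level_range _ _ _ _ _ O). split; lra.
Qed.

Let v_start : v 0 = 0.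
Proof. unfold v, angle. apply (RInt_point (V := R_CompleteNormedModule)). Qed.

Let S_start : S 0 = 0.
Proof. unfold S. rewrite (orbit_y_start _ _ _ _ _ O). unfold Rdiv. ring. Qed.

Let v_incr a b : a < b -> v a < v b.
Proof.
  intros L. destruct (MVT_cor2 v q a b L) as [c [Ec _]].
  - intros c _. apply is_derive_Reals, angle_derive.
  - pose proof (q_pos c). nra.
Qed.

Let v_continuous : continuity v.
Proof.
  intros t. apply continuity_pt_filterlim. exact (is_derive_continuous _ _ _ (angle_derive t)).
Qed.

Let constant_of_derive_0 (f : R -> R) a b : (forall t, is_derive f t 0) -> f a = f b.
Proof.
  intros D. destruct (Rtotal_order a b) as [L|[->|L]]; [| reflexivity |].
  - apply (eq_is_derive (V := R_NormedModule) f); auto.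
  - symmetry. apply (eq_is_derive (V := R_NormedModule) f); auto.
Qed.

(** Turning the vector (C, S) back by the angle [v] gives a vector with derivative 0, which stays at
    its initial value (C 0, 0). *)
Let rotation t : C t = C 0 * cos (v t) /\ S t = C 0 * sin (v t).
Proof.
  assert (EA : C t * cos (v t) + S t * sin (v t) = C 0).
  { rewrite <- (constant_of_derive_0 (fun u => C u * cos (v u) + S u * sin (v u)) 0 t).
    - rewrite v_start, S_start, cos_0, sin_0. ring.
    - intros u. pose proof (dC u) as D1. pose proof (dS u) as D2.
      pose proof (angle_derive u) as D3.
      auto_derive; [repeat split; eexists; eassumption |].
      rewrite (Derive_eta _ _ _ D1),
        (Derive_eta _ _ _ D2), (Derive_eta _ _ _ D3).
      ring. }
  assert (EB : S t * cos (v t) - C t * sin (v t) = 0).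
  { rewrite <- (constant_of_derive_0 (fun u => S u * cos (v u) - C u * sin (v u)) 0 t).
    - rewrite v_start, S_start, cos_0, sin_0. ring.
    - intros u. pose proof (dC u) as D1. pose proof (dS u) as D2.
      pose proof (angle_derive u) as D3.
      auto_derive; [repeat split; eexists; eassumption |].
      rewrite (Derive_eta _ _ _ D1),
        (Derive_eta _ _ _ D2), (Derive_eta _ _ _ D3).
      ring. }
  pose proof (sin2_cos2 (v t)) as E. unfold Rsqr in E. rewrite <- EA. split.
  - transitivity (C t * (sin (v t) * sin (v t) + cos (v t) * cos (v t))
      + sin (v t) * (S t * cos (v t) - C t * sin (v t))); [rewrite E, EB; ring | ring].
  - transitivity (S t * (sin (v t) * sin (v t) + cos (v t) * cos (v t))
      - cos (v t) * (S t * cos (v t) - C t * sin (v t))); [rewrite E, EB; ring | ring].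
Qed.

Let S_sign_pos t : 0 < y t -> 0 < S t.
Proof.
  intros Hy. unfold S. pose proof (xp t). pose proof (q_pos t). pose proof s_range.
  apply Rdiv_lt_0_compat; [exact Hy|]. repeat apply Rmult_lt_0_compat; lra.
Qed.

Let S_sign_neg t : y t < 0 -> S t < 0.
Proof.
  intros Hy. unfold S. pose proof (xp t). pose proof (q_pos t). pose proof s_range.
  apply Rdiv_neg_pos; [exact Hy|]. repeat apply Rmult_lt_0_compat; lra.
Qed.

Let v_hits b w : 0 < w < v b -> 0 < b -> exists t, 0 < t < b /\ v t = w.
Proof.
  intros Hw Hb.
  destruct (IVT (fun t => v t - w) 0 b) as [t [Ht Et]].
  - apply continuity_minus; [exact v_continuous | apply continuity_const; now intros ? ?].
  - exact Hb.
  - rewrite v_start. lra.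
  - lra.
  - exists t. cbv beta in Et. split; [|lra].
    destruct Ht as [H1 H2]. split.
    + destruct H1 as [H1|<-]; [exact H1 | rewrite v_start in Et; lra].
    + destruct H2 as [H2| ->]; [exact H2 | lra].
Qed.

(** From C^2 = 1 at time 0 only the sign is open. The value -1 would give S = - sin v < 0 just after
    the start, against y > 0 there; so the orbit starts at its left end, where 1/x = 1 + s. *)
Let C_start : C 0 = 1.
Proof.
  pose proof (CS 0) as E. rewrite S_start in E.
  assert (E' : (C 0 - 1) * (C 0 + 1) = 0) by lra.
  apply Rmult_integral in E'. destruct E' as [E'|E']; [lra|]. exfalso.
  destruct (half_period _ _ _ _ _ O) as [H1 H2].
  assert (V : 0 < v tau) by (rewrite <- v_start; now apply v_incr).
  pose proof PI_RGT_0.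
  (* An angle below [PI], so that its sine is positive, and below [v tau], so that it is reached
     during the upper half. *)
  destruct (v_hits tau (Rmin (v tau) PI / 2)) as [t [Ht Et]]; [| exact H1 |].
  - assert (0 < Rmin (v tau) PI) by (apply Rmin_pos; lra).
    pose proof (Rmin_l (v tau) PI). lra.
  - pose proof (S_sign_pos t (upper_half _ _ _ _ _ O t Ht)) as P.
    rewrite (proj2 (rotation t)) in P.
    assert (0 < sin (v t)); [|nra].
    assert (0 < Rmin (v tau) PI) by (apply Rmin_pos; lra).
    pose proof (Rmin_r (v tau) PI). apply sin_gt_0; lra.
Qed.

(** Since [y tau] = 0, the sine vanishes at the angle [v tau] > 0, which rules out a value below
    [PI]. A value above [PI] would mean that [PI] is reached earlier, giving y = 0 inside the upper
    half. *)
Lemma angle_half : v tau = PI.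
Proof.
  destruct (half_period _ _ _ _ _ O) as [H1 H2].
  assert (V : 0 < v tau) by (rewrite <- v_start; now apply v_incr).
  pose proof PI_RGT_0.
  assert (E : sin (v tau) = 0).
  { pose proof (proj2 (rotation tau)) as E. rewrite C_start in E.
    unfold S in E. rewrite (orbit_y_half _ _ _ _ _ O) in E. unfold Rdiv in E. lra. }
  destruct (Rtotal_order (v tau) PI) as [L|[L|L]]; [| exact L |]; exfalso.
  - pose proof (sin_gt_0 (v tau) V L). lra.
  - destruct (v_hits tau PI) as [t [Ht Et]]; [lra | exact H1 |].
    pose proof (S_sign_pos t (upper_half _ _ _ _ _ O t Ht)) as P.
    rewrite (proj2 (rotation t)), Et, sin_PI in P. lra.
Qed.

Lemma angle_end : v T = 2 * PI.
Proof.
  destruct (half_period _ _ _ _ _ O) as [H1 H2].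
  pose proof (v_incr tau T H2) as V. rewrite angle_half in V.
  pose proof PI_RGT_0.
  assert (E : sin (v T) = 0).
  { pose proof (proj2 (rotation T)) as E. rewrite C_start in E.
    unfold S in E. replace (y T) with (y 0) in E.
    - rewrite (orbit_y_start _ _ _ _ _ O) in E. unfold Rdiv in E. lra.
    - rewrite <- (Rplus_0_l T). symmetry.
      apply (periodic _ _ _ _ (orbit_closed _ _ _ _ _ O)). }
  destruct (Rtotal_order (v T) (2 * PI)) as [L|[L|L]]; [| exact L |]; exfalso.
  - pose proof (sin_lt_0 (v T) V L). lra.
  - destruct (v_hits T (2 * PI)) as [t [Ht Et]]; [lra | lra |].
    assert (Lt : tau < t).
    { destruct (Rlt_le_dec tau t) as [Q|Q]; [exact Q|]. exfalso.
      destruct Q as [Q|Q].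
      - apply v_incr in Q. rewrite angle_half in Q. lra.
      - subst t. rewrite angle_half in Et. lra. }
    pose proof (S_sign_neg t (lower_half _ _ _ _ _ O t (conj Lt (proj2 Ht)))) as P.
    rewrite (proj2 (rotation t)), Et, sin_2PI in P. lra.
Qed.

Lemma orbit_x_angle t : / x t = 1 + s * cos (v t).
Proof.
  pose proof (proj1 (rotation t)) as E. rewrite C_start in E. unfold C in E.
  rewrite Rmult_1_l in E. rewrite <- E. pose proof s_range. field.
  split; [specialize (xp t); lra | lra].
Qed.

Lemma orbit_y_angle t : y t = s * sin (v t) * (x t * q t).
Proof.
  pose proof (proj2 (rotation t)) as E. rewrite C_start in E. unfold S in E.
  rewrite Rmult_1_l in E. rewrite <- E. pose proof s_range.
  pose proof (xp t). pose proof (q_pos t). field. repeat split; lra.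
Qed.

(** On the orbit y^2 = 2 s^2 x^3 sin^2 v and dt = dv / sqrt(2x), so x^(i-4) y^2 dt becomes sqrt 2
    s^2 x^(i-3/2) sin^2 v dv, with s^2 = 1 + h and 1/x = 1 + s cos v. *)
Lemma moment_one_angle (i : nat) :
  RInt (fun t => x t ^ i * y t ^ 1 * (x t * y t) / x t ^ 5) 0 T =
  (1 + h) * (sqrt 2 *
    RInt (fun w => Rpower (1 + s * cos w) (3 / 2 - INR i) * sin w ^ 2) 0 (2 * PI)).
Proof.
  pose proof s_range as Hs.
  set (G := fun w => Rpower (1 + s * cos w) (3 / 2 - INR i) * sin w ^ 2).
  assert (P1 : forall w, 0 < 1 + s * cos w).
  { intros w. pose proof (COS_bound w). nra. }
  assert (CG : forall w, continuous G w).
  { intros w. apply (ex_derive_continuous (V := R_NormedModule)).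
    unfold G, Rpower. auto_derive. specialize (P1 w). lra. }
  pose proof (RInt_comp (V := R_CompleteNormedModule) G v q 0 T) as E.
  rewrite v_start, angle_end in E. rewrite <- E; clear E.
  2:{ intros; apply CG. }
  2:{ intros t _. split; [apply angle_derive | eapply is_derive_continuous, dq]. }
  rewrite <- Rmult_assoc, <- s_sqr.
  assert (CI : forall t, continuous (fun t => scal (q t) (G (v t))) t).
  { intros t. apply (continuous_scal (K := R_AbsRing) (V := R_NormedModule)).
    - eapply is_derive_continuous, dq.
    - apply (continuous_comp v G); [eapply is_derive_continuous, angle_derive | apply CG]. }
  pose proof (RInt_scal (V := R_CompleteNormedModule) (fun t => scal (q t) (G (v t))) 0 T
    (s ^ 2 * sqrt 2)
    (ex_RInt_continuous (V := R_CompleteNormedModule) _ _ _ (fun t _ => CI t))) as E.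
  unfold scal at 3 in E; simpl in E; unfold mult in E; simpl in E.
  change (RInt (fun t => x t ^ i * y t ^ 1 * (x t * y t) / x t ^ 5) 0 T
    = s ^ 2 * sqrt 2 * RInt (fun y0 => scal (q y0) (G (v y0))) 0 T).
  simpl pow at 4. rewrite <- E. apply RInt_ext. intros t _.
  unfold scal; simpl; unfold mult; simpl. unfold G.
  rewrite <- orbit_x_angle.
  pose proof (xp t) as P.
  assert (Eq : q t = sqrt 2 * sqrt (x t)) by (unfold q, angular_speed; apply sqrt_mult; lra).
  assert (ER : Rpower (/ x t) (3 / 2 - INR i) * sqrt (x t) * x t = x t ^ i).
  { rewrite <- (Rpower_pow i) by exact P. rewrite <- Rpower_sqrt by exact P.
    replace (Rpower (/ x t) (3 / 2 - INR i)) with (Rpower (x t) (INR i - 3 / 2)).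
    2:{ unfold Rpower. rewrite ln_Rinv by exact P. f_equal. ring. }
    rewrite <- (Rpower_1 (x t)) at 3 by exact P. rewrite <- !Rpower_plus. f_equal. field. }
  assert (E2 : sqrt 2 * sqrt 2 = 2) by (apply sqrt_sqrt; lra).
  rewrite <- ER, (orbit_y_angle t).
  set (r := Rpower (/ x t) (3 / 2 - INR i)).
  transitivity (r * sqrt (x t) * s ^ 2 * sin (v t) ^ 2 * ((q t * q t) / x t));
    [field; lra|].
  rewrite Eq at 3.
  replace (q t * q t / x t) with 2 by (rewrite (x_of_q t) at 1; pose proof (q_pos t); field; lra).
  rewrite <- E2 at 1. ring.
Qed.

End Angle.

(** * Expansion of the Melnikov function *)

(* binomial_coef (3/2 - i) k / binomial_coef (3/2) k at k = 2(t - 1). *)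
Fixpoint index_poly (i : nat) (t : R) : R :=
  match i with
  | O => 1
  | S l => (2 / (INR l - 3 / 2) * t + (INR l - 7 / 2) / (INR l - 3 / 2)) * index_poly l t
  end.

Lemma index_poly_degree (i : nat) : degree_le i (index_poly i).
Proof.
  induction i as [|i IH].
  - apply (degree_le_const 0 1).
  - now apply (degree_le_mul_linear i (2 / (INR i - 3 / 2)) ((INR i - 7 / 2) / (INR i - 3 / 2))).
Qed.

Lemma INR_not_half_odd (i k : nat) : 2 * INR i <> 2 * INR k + 3.
Proof.
  intros E. assert (E' : INR (2 * i) = INR (2 * k + 3)).
  { rewrite plus_INR, !mult_INR. simpl. lra. }
  apply INR_eq in E'. lia.
Qed.

Lemma binomial_coef_index_poly (i k : nat) :
  binomial_coef (3 / 2 - INR i) (2 * k) =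
  binomial_coef (3 / 2) (2 * k) * index_poly i (INR (S k)).
Proof.
  induction i as [|i IH].
  - simpl index_poly. rewrite Rmult_1_r. f_equal. simpl. lra.
  - pose proof (INR_not_half_odd i 0) as N. simpl in N.
    replace (3 / 2 - INR (S i)) with (3 / 2 - INR i - 1) by (rewrite S_INR; ring).
    rewrite binomial_coef_pred, IH by lra. cbn [index_poly].
    rewrite mult_INR, S_INR. change (INR 2) with 2. field. lra.
Qed.

(** The even binomial coefficients for the exponent 3/2 times the averages over the circle. The
    leading 0 and the shift by one account for the factor z = 1 + h in front of the integrals. *)
Definition weight (k : nat) : R :=
  match k with
  | O => 0
  | S m => sqrt 2 * (binomial_coef (3 / 2) (2 * m) * wallis (2 * m))
  end.

Lemma weight_nonneg (k : nat) : 0 <= weight k.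
Proof.
  destruct k as [|k]; [apply Rle_refl|].
  apply Rmult_le_pos; [apply sqrt_pos|].
  apply Rmult_le_pos; [apply binomial_coef_three_halves | apply wallis_even_nonneg].
Qed.

Definition weighted (S : R -> R) (k : nat) : R := weight k * S (INR k).

Definition Rpower_even_coef (i k : nat) : R :=
  binomial_coef (3 / 2 - INR i) (2 * k) * wallis (2 * k).

Lemma half_odd_not_nat (i k : nat) : 3 / 2 - INR i <> INR k.
Proof.
  intros E. apply (INR_not_half_odd (i + k) 0). rewrite plus_INR. simpl. lra.
Qed.

Lemma Rpower_even_series (i : nat) (z : R) : 0 < z < 1 ->
  is_pseries (Rpower_even_coef i) z
    (RInt (fun w => Rpower (1 + sqrt z * cos w) (3 / 2 - INR i) * sin w ^ 2) 0 (2 * PI)).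
Proof.
  intros Hz. rewrite <- (pow2_sqrt z) at 1 by lra.
  apply Rpower_cos_series; [apply half_odd_not_nat|].
  split; [apply sqrt_lt_R0; lra|]. rewrite <- sqrt_1. apply sqrt_lt_1; lra.
Qed.

Lemma weighted_index_poly (i k : nat) :
  weighted (index_poly i) k = PS_incr_1 (PS_scal (sqrt 2) (Rpower_even_coef i)) k.
Proof.
  destruct k as [|k].
  - unfold weighted, PS_incr_1, zero; simpl. ring.
  - change (sqrt 2 * (binomial_coef (3 / 2) (2 * k) * wallis (2 * k)) * index_poly i (INR (S k))
      = sqrt 2 * (binomial_coef (3 / 2 - INR i) (2 * k) * wallis (2 * k))).
    rewrite binomial_coef_index_poly. ring.
Qed.

Lemma weighted_index_poly_radius (i : nat) :
  Rbar_le 1 (CV_radius (weighted (index_poly i))).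
Proof.
  rewrite (CV_radius_ext _ _ (weighted_index_poly i)), CV_radius_incr_1.
  apply radius_scal_ge, radius_ge_one. intros z Hz. eexists. now apply Rpower_even_series.
Qed.

(* F is an integrand with respect to the time of the flow. *)
Definition expands (n : nat) (F : R -> R -> R) : Prop :=
  (forall h x y tau T, oriented_orbit h x y tau T ->
     forall t, continuous (fun t => F (x t) (y t)) t) /\
  exists S, degree_le n S /\ Rbar_le 1 (CV_radius (weighted S)) /\
    forall h x y tau T, oriented_orbit h x y tau T ->
      RInt (fun t => F (x t) (y t)) 0 T = PSeries (weighted S) (1 + h).

Lemma expands_integrable (n : nat) (F : R -> R -> R) (h : R) (x y : R -> R) (tau T a b : R) :
  expands n F -> oriented_orbit h x y tau T -> ex_RInt (fun t => F (x t) (y t)) a b.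
Proof.
  intros [CF _] O. apply (ex_RInt_continuous (V := R_CompleteNormedModule)).
  intros t _. eapply CF, O.
Qed.

Lemma expands_ext (n : nat) (F G : R -> R -> R) :
  (forall x y, 0 < x -> F x y = G x y) -> expands n F -> expands n G.
Proof.
  intros E [CF [S [DS [RS HS]]]].
  assert (P : forall h x y tau T, oriented_orbit h x y tau T ->
    forall t, F (x t) (y t) = G (x t) (y t)).
  { intros h x y tau T O t. apply E, (x_pos _ _ _ _ (orbit_closed _ _ _ _ _ O)). }
  split.
  - intros h x y tau T O t. apply continuous_ext with (fun t => F (x t) (y t)).
    + intros u. eapply P, O.
    + eapply CF, O.
  - exists S. split; [exact DS|]. split; [exact RS|]. intros h x y tau T O.
    rewrite <- (HS h x y tau T O). apply RInt_ext. intros t _. symmetry. eapply P, O.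
Qed.

Lemma expands_weaken (m n : nat) (F : R -> R -> R) :
  (m <= n)%nat -> expands m F -> expands n F.
Proof.
  intros L [CF [S [DS HS]]]. split; [exact CF|]. exists S.
  split; [now apply degree_le_weaken with m | exact HS].
Qed.

Lemma expands_scal (n : nat) (c : R) (F : R -> R -> R) :
  expands n F -> expands n (fun x y => c * F x y).
Proof.
  intros EF. pose proof EF as [CF [S [DS [RS HS]]]].
  assert (E : forall k, PS_scal c (weighted S) k = weighted (fun t => c * S t) k).
  { intros k. unfold PS_scal, weighted, scal; simpl; unfold mult; simpl. ring. }
  split.
  - intros h x y tau T O t.
    apply (continuous_scal_r (K := R_AbsRing) (V := R_NormedModule) c). eapply CF, O.
  - exists (fun t => c * S t). split; [now apply degree_le_scal|]. split.
    + rewrite <- (CV_radius_ext _ _ E). now apply radius_scal_ge.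
    + intros h x y tau T O.
      rewrite <- (PSeries_ext _ _ _ E), PSeries_scal, <- (HS h x y tau T O).
      apply (RInt_scal (V := R_CompleteNormedModule)). eapply expands_integrable; eassumption.
Qed.

Lemma expands_plus (n : nat) (F G : R -> R -> R) :
  expands n F -> expands n G -> expands n (fun x y => F x y + G x y).
Proof.
  intros EF EG. pose proof EF as [CF [S [DS [RS HS]]]]. pose proof EG as [CG [U [DU [RU HU]]]].
  assert (E : forall k, PS_plus (weighted S) (weighted U) k = weighted (fun t => S t + U t) k).
  { intros k. unfold PS_plus, weighted, plus; simpl. ring. }
  split.
  - intros h x y tau T O t.
    apply (continuous_plus (V := R_NormedModule) (fun t => F (x t) (y t)) (fun t => G (x t) (y t)));
      [eapply CF, O | eapply CG, O].
  - exists (fun t => S t + U t). split; [now apply degree_le_plus|]. split.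
    + rewrite <- (CV_radius_ext _ _ E). now apply radius_plus_ge.
    + intros h x y tau T O. destruct (level_range _ _ _ _ _ O) as [H1 H2].
      assert (A : Rabs (1 + h) < 1) by (apply Rabs_def1; lra).
      rewrite <- (PSeries_ext _ _ _ E), PSeries_plus
        by now apply CV_radius_inside, Rbar_lt_radius.
      rewrite <- (HS h x y tau T O), <- (HU h x y tau T O).
      apply (RInt_plus (V := R_CompleteNormedModule)); eapply expands_integrable; eassumption.
Qed.

Lemma expands_sum (n N : nat) (F : nat -> R -> R -> R) :
  (forall i, (i <= N)%nat -> expands n (F i)) ->
  expands n (fun x y => sum_f_R0 (fun i => F i x y) N).
Proof.
  induction N as [|N IH]; intros HF; simpl.
  - apply (HF 0%nat). lia.
  - apply expands_plus; [apply IH; intros; apply HF; lia | apply HF; lia].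
Qed.

(** Serves the two kinds of integrands that cancel over a period: exact forms, and forms with an
    even power of y. *)
Lemma expands_zero (n : nat) (F : R -> R -> R) :
  (forall h x y tau T, oriented_orbit h x y tau T ->
     forall t, continuous (fun t => F (x t) (y t)) t) ->
  (forall h x y tau T, oriented_orbit h x y tau T ->
     RInt (fun t => F (x t) (y t)) 0 T = 0) ->
  expands n F.
Proof.
  intros CF HF. split; [exact CF|].
  assert (E : forall k, 0 = weighted (fun _ => 0) k) by (intros k; unfold weighted; ring).
  exists (fun _ => 0). split; [apply degree_le_const|]. split.
  - rewrite <- (CV_radius_ext _ _ E), CV_radius_const_0. exact I.
  - intros h x y tau T O. rewrite <- (PSeries_ext _ _ _ E), PSeries_const_0. eapply HF, O.
Qed.

(* Integrand of x^(i-5) y^j dx with respect to the time of the flow. *)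
Definition moment (i j : nat) (x y : R) : R := x ^ i * y ^ j * (x * y) / x ^ 5.

(* Derivative of x^(i-4) y^(j+1) along the flow. *)
Definition exact_moment (i j : nat) (x y : R) : R :=
  (INR i - 4) * moment i (S j) x y
  + INR (S j) * (x ^ i * y ^ j * Y0 x y / x ^ 4).

Lemma moment_continuous (i j : nat) (h : R) (x y : R -> R) (tau T : R) :
  oriented_orbit h x y tau T -> forall t, continuous (fun t => moment i j (x t) (y t)) t.
Proof.
  intros O t.
  pose proof (flow_x _ _ _ _ (orbit_closed _ _ _ _ _ O) t) as Dx.
  pose proof (flow_y _ _ _ _ (orbit_closed _ _ _ _ _ O) t) as Dy.
  pose proof (x_pos _ _ _ _ (orbit_closed _ _ _ _ _ O) t) as P.
  apply (ex_derive_continuous (V := R_NormedModule)). unfold moment. auto_derive.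
  repeat split; try (eexists; eassumption).
  repeat apply Rmult_integral_contrapositive_currified; lra.
Qed.

Lemma exact_moment_continuous (i j : nat) (h : R) (x y : R -> R) (tau T : R) :
  oriented_orbit h x y tau T -> forall t, continuous (fun t => exact_moment i j (x t) (y t)) t.
Proof.
  intros O t.
  pose proof (flow_x _ _ _ _ (orbit_closed _ _ _ _ _ O) t) as Dx.
  pose proof (flow_y _ _ _ _ (orbit_closed _ _ _ _ _ O) t) as Dy.
  pose proof (x_pos _ _ _ _ (orbit_closed _ _ _ _ _ O) t) as P.
  apply (ex_derive_continuous (V := R_NormedModule)).
  unfold exact_moment, moment, Y0. auto_derive.
  repeat split; try (eexists; eassumption);
  repeat apply Rmult_integral_contrapositive_currified; lra.
Qed.

Lemma expands_exact_moment (n i j : nat) : expands n (exact_moment i j).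
Proof.
  apply expands_zero; intros h x y tau T O.
  - apply (exact_moment_continuous i j _ _ _ _ _ O).
  - pose proof (is_RInt_derive (V := R_CompleteNormedModule)
      (fun t => x t ^ i * y t ^ S j / x t ^ 4)
      (fun t => exact_moment i j (x t) (y t)) 0 T) as E.
    apply (is_RInt_unique (V := R_CompleteNormedModule)) in E.
    + rewrite E. destruct (periodic _ _ _ _ (orbit_closed _ _ _ _ _ O) 0) as [E1 E2].
      rewrite Rplus_0_l in E1, E2. rewrite E1, E2. apply (minus_eq_zero (G := R_AbelianGroup)).
    + intros t _.
      pose proof (flow_x _ _ _ _ (orbit_closed _ _ _ _ _ O) t) as Dx.
      pose proof (flow_y _ _ _ _ (orbit_closed _ _ _ _ _ O) t) as Dy.
      pose proof (x_pos _ _ _ _ (orbit_closed _ _ _ _ _ O) t) as P.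
      auto_derive.
      * repeat split; try (eexists; eassumption).
        repeat apply Rmult_integral_contrapositive_currified; lra.
      * rewrite (Derive_eta _ _ _ Dx), (Derive_eta _ _ _ Dy).
        change (match j with O => 1 | S _ => INR j + 1 end) with (INR (S j)).
        unfold exact_moment, moment, X0. destruct i as [|i]; cbn [Nat.pred pow].
        -- change (INR 0) with 0. field. lra.
        -- field. lra.
    + intros t _. apply (exact_moment_continuous i j _ _ _ _ _ O).
Qed.

(** On a level, y^2 is a polynomial in x, so the form is phi(x) dx; after one period x is back at
    its initial value and the integral runs from a point to itself. *)
Lemma expands_moment_even (n i l : nat) : expands n (moment i (2 * l)).
Proof.
  apply expands_zero; intros h x y tau T O.
  - apply (moment_continuous i (2 * l) _ _ _ _ _ O).
  - set (phi := fun u => u ^ i * (2 * (h * u ^ 3 + 2 * u ^ 2 - u)) ^ l / u ^ 5).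
    pose proof (RInt_comp (V := R_CompleteNormedModule) phi x
      (fun t => X0 (x t) (y t)) 0 T) as E.
    destruct (periodic _ _ _ _ (orbit_closed _ _ _ _ _ O) 0) as [E1 _].
    rewrite Rplus_0_l in E1. rewrite E1, RInt_point in E.
    transitivity (RInt (fun t => scal (X0 (x t) (y t)) (phi (x t))) 0 T).
    + apply RInt_ext. intros t _. unfold scal; simpl; unfold mult; simpl.
      unfold phi, moment, X0. rewrite <- (orbit_level _ _ _ _ _ t O), <- pow_mult.
      pose proof (x_pos _ _ _ _ (orbit_closed _ _ _ _ _ O) t) as P.
      replace (l + (l + 0))%nat with (2 * l)%nat by lia. field. lra.
    + apply E.
      * intros t _. pose proof (x_pos _ _ _ _ (orbit_closed _ _ _ _ _ O) t) as P.
        apply (ex_derive_continuous (V := R_NormedModule)). unfold phi. auto_derive.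
        repeat apply Rmult_integral_contrapositive_currified; lra.
      * intros t _.
        pose proof (flow_x _ _ _ _ (orbit_closed _ _ _ _ _ O) t) as Dx.
        pose proof (flow_y _ _ _ _ (orbit_closed _ _ _ _ _ O) t) as Dy.
        split; [exact Dx|].
        apply (ex_derive_continuous (V := R_NormedModule)). unfold X0. auto_derive.
        repeat split; eexists; eassumption.
Qed.

Lemma expands_moment_one (i : nat) : expands i (moment i 1).
Proof.
  split; [apply (moment_continuous i 1)|].
  exists (index_poly i). split; [apply index_poly_degree|].
  split; [apply weighted_index_poly_radius|].
  intros h x y tau T O. destruct (level_range _ _ _ _ _ O) as [H1 H2].
  rewrite (PSeries_ext _ _ _ (weighted_index_poly i)), PSeries_incr_1, PSeries_scal.
  unfold moment. rewrite (moment_one_angle h x y tau T O i). do 2 f_equal.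
  symmetry. apply is_series_unique, is_pseries_R, Rpower_even_series. lra.
Qed.

(** Substituting [Y0] relates the power y^(j+2) to y^j: up to an exact form, y^2 is exchanged for a
    combination of x^2 and x. *)
Lemma exact_moment_reduce (i j : nat) (x y : R) : 0 < x ->
  exact_moment i (S j) x y =
  (INR i - 4 + 3 / 2 * INR (S (S j))) * moment i (S (S j)) x y
  - 2 * INR (S (S j)) * (moment (S (S i)) j x y - moment (S i) j x y).
Proof.
  intros Hx. unfold exact_moment, moment, Y0. cbn [pow]. field. lra.
Qed.

Lemma expands_moment_odd (l i : nat) : expands (i + 2 * l) (moment i (S (2 * l))).
Proof.
  revert i. induction l as [|l IH]; intros i.
  - replace (i + 2 * 0)%nat with i by lia. apply expands_moment_one.
  - replace (S (2 * S l)) with (S (S (S (2 * l)))) by lia.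
    set (j := S (2 * l)) in *. set (c := INR i - 4 + 3 / 2 * INR (S (S j))).
    (* The reduction is solved for the highest power of y, so its coefficient must not vanish. If it
       did, then 2i + 3(2l + 3) = 8, an odd number equal to an even one. *)
    assert (Hc : c <> 0).
    { intros E. unfold c, j in E.
      assert (E' : INR (2 * i + 3 * S (S (S (2 * l)))) = INR 8)
        by (rewrite plus_INR, !mult_INR; change (INR 2) with 2; replace (INR 3) with 3
              by (simpl; ring); replace (INR 8) with 8 by (simpl; ring); lra).
      apply INR_eq in E'. lia. }
    apply expands_ext with (fun x y => / c * (exact_moment i (S j) x y
      + 2 * INR (S (S j)) * (moment (S (S i)) j x y + -1 * moment (S i) j x y))).
    + intros x y Hx. rewrite (exact_moment_reduce i j x y Hx). fold c. field. exact Hc.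
    + apply expands_scal, expands_plus; [apply expands_exact_moment|].
      apply expands_scal, expands_plus; [|apply expands_scal].
      * apply expands_weaken with (S (S i) + 2 * l)%nat; [lia | apply IH].
      * apply expands_weaken with (S i + 2 * l)%nat; [lia | apply IH].
Qed.

Lemma expands_moment (n i j : nat) : (i + j <= S n)%nat -> expands n (moment i j).
Proof.
  intros L. destruct (Nat.Even_or_Odd j) as [[l ->]|[l ->]].
  - apply expands_moment_even.
  - rewrite Nat.add_1_r in *. apply expands_weaken with (i + 2 * l)%nat; [lia|].
    apply expands_moment_odd.
Qed.

Definition melnikov_integrand (n : nat) (a b : nat -> nat -> R) (x y : R) : R :=
  / x ^ 4 * poly2 n b x y * X0 x y + - (/ x ^ 4 * poly2 n a x y) * Y0 x y.

(** The terms in dy are integrated by parts: (j+1) x^(i-4) y^j dy is the exact form d(x^(i-4)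
    y^(j+1)) plus (4-i) x^(i-5) y^(j+1) dx. Both kinds of terms thus lead to moments of total degree
    at most n + 1. *)
Lemma expands_melnikov (n : nat) (a b : nat -> nat -> R) :
  expands n (melnikov_integrand n a b).
Proof.
  apply expands_ext with (fun x y => sum_f_R0 (fun i => sum_f_R0 (fun j =>
    b i j * moment (S i) j x y + - (a i j / INR (S j)) *
      (exact_moment i j x y + (4 - INR i) * moment i (S j) x y)) (n - i)) n).
  - intros x y Hx. unfold melnikov_integrand, poly2.
    replace (/ x ^ 4 * sum_f_R0 (fun i => sum_f_R0 (fun j => b i j * x ^ i * y ^ j) (n - i)) n
      * X0 x y + - (/ x ^ 4 * sum_f_R0 (fun i => sum_f_R0 (fun j => a i j * x ^ i * y ^ j)
      (n - i)) n) * Y0 x y)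
      with ((/ x ^ 4 * X0 x y) *
        sum_f_R0 (fun i => sum_f_R0 (fun j => b i j * x ^ i * y ^ j) (n - i)) n
        + (- / x ^ 4 * Y0 x y) *
        sum_f_R0 (fun i => sum_f_R0 (fun j => a i j * x ^ i * y ^ j) (n - i)) n) by ring.
    rewrite !scal_sum, <- sum_plus. apply sum_eq. intros i _.
    rewrite !(Rmult_comm (sum_f_R0 _ _)), !scal_sum, <- sum_plus. apply sum_eq. intros j _.
    unfold exact_moment, moment, X0. cbn [pow].
    assert (INR (S j) <> 0) by (apply not_0_INR; lia). field. lra.
  - apply expands_sum. intros i Hi. apply expands_sum. intros j Hj.
    apply expands_plus; apply expands_scal.
    + apply expands_moment. lia.
    + apply expands_plus; [apply expands_exact_moment|].
      apply expands_scal, expands_moment. lia.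
Qed.

Lemma poly2_ext (n : nat) (a b : nat -> nat -> R) (x y : R) :
  (forall i j, (i + j <= n)%nat -> a i j = b i j) -> poly2 n a x y = poly2 n b x y.
Proof.
  intros E. unfold poly2. apply sum_eq. intros i Hi. apply sum_eq. intros j Hj.
  rewrite E by lia. reflexivity.
Qed.

Lemma melnikov_arc_integrand (n : nat) (a b a' b' : nat -> nat -> R)
    (h : R) (x y : R -> R) (tau T u v : R) :
  (forall i j, (i + j <= n)%nat -> a i j = a' i j) ->
  (forall i j, (i + j <= n)%nat -> b i j = b' i j) ->
  oriented_orbit h x y tau T ->
  melnikov_arc (poly2 n a) (poly2 n b) x y u v =
  RInt (fun t => melnikov_integrand n a' b' (x t) (y t)) u v.
Proof.
  intros Ea Eb O. unfold melnikov_arc, line_integral. apply RInt_ext. intros t _.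
  rewrite (is_derive_unique _ _ _ (flow_x _ _ _ _ (orbit_closed _ _ _ _ _ O) t)),
    (is_derive_unique _ _ _ (flow_y _ _ _ _ (orbit_closed _ _ _ _ _ O) t)).
  unfold melnikov_integrand. rewrite (poly2_ext n a a'), (poly2_ext n b b') by assumption.
  reflexivity.
Qed.

(** Because the coefficients agree on both sides, the two arcs carry the same integrand and add up
    to an integral over the full period, to which the expansion applies. *)
Lemma melnikov_series (n : nat) (ap bp am bm : nat -> nat -> R) (M : R -> R)
    (ha : forall i j, (i + j <= n)%nat -> ap i j = am i j)
    (hb : forall i j, (i + j <= n)%nat -> bp i j = bm i j)
    (hM : forall h, -1 < h < 0 ->
       is_melnikov (poly2 n ap) (poly2 n bp) (poly2 n am) (poly2 n bm) h (M h)) :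
  exists S, degree_le n S /\ Rbar_le 1 (CV_radius (weighted S)) /\
    forall h, -1 < h < 0 -> M h = PSeries (weighted S) (h + 1).
Proof.
  pose proof (expands_melnikov n am bm) as EX.
  pose proof EX as [_ [S [DS [RS HS]]]].
  exists S. split; [exact DS|]. split; [exact RS|]. intros h Hh.
  destruct (hM h Hh) as [x [y [tau [T [Cl [Ht [Hp [Hn E]]]]]]]].
  assert (O : oriented_orbit h x y tau T) by (constructor; assumption).
  rewrite E, (melnikov_arc_integrand n ap bp am bm h x y tau T 0 tau ha hb O),
    (melnikov_arc_integrand n am bm am bm h x y tau T tau T) by auto.
  rewrite Rplus_comm with (r1 := h), <- (HS h x y tau T O).
  apply (RInt_Chasles (V := R_CompleteNormedModule)); eapply expands_integrable; eassumption.
Qed.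

(** * From the power series back to the isolated zeros of M *)

Lemma locally_open_interval (a b h : R) : a < h < b -> locally h (fun u => a < u < b).
Proof.
  intros Hh. apply (open_and (fun u => a < u) (fun u => u < b)); [apply open_gt | apply open_lt | exact Hh].
Qed.

Lemma isolated_zeros_at_most_degree (n : nat) (S : R -> R) (M : R -> R) :
  degree_le n S -> Rbar_le 1 (CV_radius (weighted S)) ->
  (forall h, -1 < h < 0 -> M h = PSeries (weighted S) (h + 1)) ->
  isolated_zeros_at_most M (-1) 0 n.
Proof.
  intros DS RS EM l ND Hl.
  destruct l as [|[h0 k0] l0] eqn:El; [apply Nat.le_0_l|]. rewrite <- El in *.
  (* An isolated zero has nearby points where [M] is nonzero, so the series is not identically zero,
     as Descartes' rule requires; with an empty list there is nothing to count. *)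
  assert (N : exists z, 0 < z < 1 /\ PSeries (weighted S) z <> 0).
  { destruct (Hl h0 k0) as [Hh [[_ Hi] _]]; [rewrite El; now left|].
    pose proof (filter_and (F := locally h0) _ _ (locally_open_interval _ _ _ Hh) Hi) as [d Hd].
    assert (Hu : ball h0 d (h0 + d / 2)).
    { unfold ball; simpl; unfold AbsRing_ball, abs, minus, plus, opp; simpl.
      pose proof (cond_pos d). rewrite Rabs_pos_eq; lra. }
    destruct (Hd _ Hu) as [R1 R2]. exists (h0 + d / 2 + 1). split; [lra|].
    rewrite <- EM by exact R1. apply R2. pose proof (cond_pos d). lra. }
  destruct N as [z0 [Hz0 N0]].
  set (shift := fun p : R * nat => (fst p + 1, snd p)).
  destruct (zeros_from_sort (weighted S) (map shift l)) as [l' [Z' E']].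
  - rewrite map_map. simpl.
    rewrite <- (map_map fst (fun u => u + 1)). apply Injective_map_NoDup; [|exact ND].
    intros u v E. lra.
  - intros z k Hin. apply in_map_iff in Hin. destruct Hin as [[h k'] [E Hin]].
    unfold shift in E; simpl in E. injection E as <- <-.
    destruct (Hl h k' Hin) as [Hh [_ Hk]]. split; [lra|]. intros j Hj.
    rewrite <- (Hk j Hj).
    (* [M] agrees with the shifted series on a whole neighbourhood of [h], so its derivatives there
       are the formal derivatives at h + 1. *)
    rewrite <- Derive_n_PSeries
      by (apply Rbar_lt_radius; [exact RS | apply Rabs_def1; lra]).
    rewrite <- (Derive_n_comp_trans (PSeries (weighted S)) j h 1).
    apply Derive_n_ext_loc. apply filter_imp with (fun u => -1 < u < 0).
    + intros u Hu. symmetry. now apply EM.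
    + now apply locally_open_interval.
  - rewrite map_map in E'. change (list_sum (map snd l') = list_sum (map snd l)) in E'.
    rewrite <- E'. apply (descartes_polynomial n S weight (weighted S) z0); auto using weight_nonneg.
Qed.

Theorem theorem1p2 (n : nat) (ap bp am bm : nat -> nat -> R) (M : R -> R)
    (hn : (2 <= n)%nat)
    (ha : forall i j, (i + j <= n)%nat -> ap i j = am i j)
    (hb : forall i j, (i + j <= n)%nat -> bp i j = bm i j)
    (hM : forall h, -1 < h < 0 ->
       is_melnikov (poly2 n ap) (poly2 n bp) (poly2 n am) (poly2 n bm) h (M h)) :
  (n = 2%nat \/ n = 3%nat -> isolated_zeros_at_most M (-1) 0 4) /\
  ((4 <= n)%nat -> isolated_zeros_at_most M (-1) 0 (3 * n - 8)).
Proof.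
  destruct (melnikov_series n ap bp am bm M ha hb hM) as [S [DS [RS EM]]].
  pose proof (isolated_zeros_at_most_degree n S M DS RS EM) as B.
  split; intros Hn l ND Hl; specialize (B l ND Hl); lia.
Qed.
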